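(* For every $m\in\mathbb Z$, $\mathrm{Fib}(m)$ is an $\mathfrak h_{\mathrm{Fib}}$-diagonalizable, integrable $\mathrm{Fib}$-module, where the action is the restriction to $\mathrm{Fib}$ of the adjoint action of $\mathcal F$. In particular: 1) the set of weights of $\mathrm{Fib}(m)$ is $P(\mathrm{Fib}(m))=\pi(\Delta_m)$; 2) if $\beta\in\Delta_m$ and $x\in\mathcal F_\beta$, then $[H,x]=\pi(\beta)(H)\,x$ for all $H\in\mathfrak h_{\mathrm{Fib}}$; 3) $\Delta_m$ and $P(\mathrm{Fib}(m))$ are $W_{\mathrm{Fib}}$-invariant; 4) $\pi(\beta_i^\perp)=\mathbb R\lambda_{3-i}=\beta_i^\perp\cap(\mathbb R\beta_1\oplus\mathbb R\beta_2)$ for $i=1,2$; 5) $\pi(P^{+})\subset P^{+}_{\mathrm{Fib}}$ and $\pi(P^{-})\subset P^{-}_{\mathrm{Fib}}$.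
   Context: Let $A=(a_{ij})=\begin{pmatrix}2&-2&0\\-2&2&-1\\0&-1&2\end{pmatrix}$ and let $\mathcal F$ be the Kac–Moody Lie algebra over $\mathbb C$ with generalized Cartan matrix $A$: generators $h_i,e_i,f_i$ ($i=1,2,3$), relations $[h_i,h_j]=0$, $[h_i,e_j]=a_{ij}e_j$, $[h_i,f_j]=-a_{ij}f_j$, $[e_i,f_j]=\delta_{ij}h_i$, $(\mathrm{ad}\,e_i)^{1-a_{ij}}e_j=0=(\mathrm{ad}\,f_i)^{1-a_{ij}}f_j$ for $i\ne j$. Cartan subalgebra $\mathfrak h=\bigoplus_i\mathbb Ch_i$, with real form of its dual $\mathfrak h_{\mathbb R}^*=\bigoplus_i\mathbb R\alpha_i$; simple roots $\alpha_1,\alpha_2,\alpha_3\in\mathfrak h^*$ with $\alpha_j(h_i)=a_{ij}$; bilinear form on $\mathfrak h^*$ with $(\alpha_i,\alpha_j)=a_{ij}$; $\langle\alpha,\mu\rangle=2(\alpha,\mu)/(\alpha,\alpha)$; $\Phi$ is the set of roots and $\mathcal F_\alpha$ the root spaces, $\mathcal F_0=\mathfrak h$. $P=\{\omega\in\mathfrak h^*:\langle\alpha_j,\omega\rangle\in\mathbb Z,\ j=1,2,3\}$, $P^+=\{\omega\in P:\langle\alpha_j,\omega\rangle\ge0,\ j=1,2,3\}$, $P^-=-P^+$. Let $e_{1123}=[e_1,[e_1,[e_2,e_3]]]$ and $f_{1123}=[f_1,[f_1,[f_2,f_3]]]$. Put $\beta_1=2\alpha_1+\alpha_2+\alpha_3$,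 $\beta_2=\alpha_2$, $E_1=\frac12e_{1123}$, $F_1=-\frac12f_{1123}$, $H_1=2h_1+h_2+h_3$, $E_2=e_2$, $F_2=f_2$, $H_2=h_2$. $\mathrm{Fib}$ is the subalgebra of $\mathcal F$ generated by $E_i,F_i,H_i$ ($i=1,2$); it is isomorphic to the Kac–Moody algebra with Cartan matrix $\begin{pmatrix}2&-3\\-3&2\end{pmatrix}$, with Cartan subalgebra $\mathfrak h_{\mathrm{Fib}}=\mathbb CH_1\oplus\mathbb CH_2$, and $\mathfrak h_{\mathrm{Fib}}^*$ is identified with $\mathbb C\beta_1\oplus\mathbb C\beta_2$. Fundamental weights $\lambda_1=-\frac15(2\beta_1+3\beta_2)$, $\lambda_2=-\frac15(3\beta_1+2\beta_2)$, so $\lambda_j(H_i)=\delta_{ij}$; $P_{\mathrm{Fib}}=\mathbb Z\lambda_1+\mathbb Z\lambda_2$, $P_{\mathrm{Fib}}^+=\mathbb Z_{\ge0}\lambda_1+\mathbb Z_{\ge0}\lambda_2$, $P_{\mathrm{Fib}}^-=-P_{\mathrm{Fib}}^+$. $W_{\mathrm{Fib}}=\langle r_1,r_2\rangle$ with $r_i\mu=\mu-\langle\beta_i,\mu\rangle\beta_i$. $\beta_i^\perp=\{\mu\in\mathfrak h_{\mathbb R}^*:(\mu,\beta_i)=0\}$. For $m\in\mathbb Z$, $\Delta_m=\{x\alpha_1+y\alpha_2+z\alpha_3\in\Phi: 2z-x=m\}$ (the roots of level $m$, lying in the plane $\mathbb R\beta_1\oplus\mathbb R\beta_2+m(-\alpha_1-\alpha_2)$);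 for $m=0$ the element $0$ is included in $\Delta_0$. $\mathrm{Fib}(m)=\bigoplus_{\beta\in\Delta_m}\mathcal F_\beta$, so $\mathcal F=\bigoplus_m\mathrm{Fib}(m)$ and $\mathfrak h\subset\mathrm{Fib}(0)$. The projection $\pi:\mathfrak h_{\mathbb R}^*\to\mathbb R\beta_1\oplus\mathbb R\beta_2$ is $\pi(\mu)=\mu(H_1)\lambda_1+\mu(H_2)\lambda_2$. For a $\mathrm{Fib}$-module $V$, $V_\mu=\{v: H\cdot v=\mu(H)v\ \forall H\in\mathfrak h_{\mathrm{Fib}}\}$ and $P(V)=\{\mu:V_\mu\ne0\}$; $V$ is $\mathfrak h_{\mathrm{Fib}}$-diagonalizable if $V=\bigoplus_\mu V_\mu$, and integrable if moreover $E_1,E_2,F_1,F_2$ act locally nilpotently. *)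

(* Defs.v *)
From HB Require Import structures.
From mathcomp Require Import all_boot all_order all_algebra.
From mathcomp Require Import generic_quotient complex.
From mathcomp Require Import boolp classical_sets reals.

Set Implicit Arguments.
Unset Strict Implicit.
Unset Printing Implicit Defensive.

Import Order.TTheory GRing.Theory Num.Theory.
Local Open Scope classical_set_scope.
Local Open Scope ring_scope.

HB.mixin Record Lmodule_isLieAlgebra (K : fieldType) L of GRing.Lmodule K L := {
  bracket : L -> L -> L;
  bracket_linearl : forall (a : K) (x y z : L),
    bracket (a *: x + y) z = a *: bracket x z + bracket y z;
  bracket_linearr : forall (a : K) (x y z : L),
    bracket z (a *: x + y) = a *: bracket z x + bracket z y;
  bracketxx : forall x : L, bracket x x = 0;
  bracket_jacobi : forall x y z : L,
    bracket x (bracket y z) + bracket y (bracket z x) +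
    bracket z (bracket x y) = 0
}.

#[short(type="lieAlgType")]
HB.structure Definition LieAlgebra (K : fieldType) :=
  {L of GRing.Lmodule K L & Lmodule_isLieAlgebra K L}.

(* The Lie algebra over K with generators X and relations r = 0 for r in rel:
   Lie polynomials in X modulo the smallest congruence containing the Lie
   algebra axioms and the relations. *)
Section Presentation.
Variables (K : fieldType) (X : Type).

Inductive lie_term : Type :=
  | LGen of X
  | LZero
  | LOpp of lie_term
  | LAdd of lie_term & lie_term
  | LScale of K & lie_term
  | LBracket of lie_term & lie_term.

Variable rel : lie_term -> Prop.

Inductive lie_eq : lie_term -> lie_term -> Prop :=
  | lie_refl t : lie_eq t t
  | lie_sym s t : lie_eq s t -> lie_eq t s
  | lie_trans s t u : lie_eq s t -> lie_eq t u -> lie_eq s u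
  | lie_congN s t : lie_eq s t -> lie_eq (LOpp s) (LOpp t)
  | lie_congD s s' t t' : lie_eq s s' -> lie_eq t t' ->
      lie_eq (LAdd s t) (LAdd s' t')
  | lie_congZ a s t : lie_eq s t -> lie_eq (LScale a s) (LScale a t)
  | lie_congB s s' t t' : lie_eq s s' -> lie_eq t t' ->
      lie_eq (LBracket s t) (LBracket s' t')
  | lie_addA s t u : lie_eq (LAdd s (LAdd t u)) (LAdd (LAdd s t) u)
  | lie_addC s t : lie_eq (LAdd s t) (LAdd t s)
  | lie_add0 t : lie_eq (LAdd LZero t) t
  | lie_addN t : lie_eq (LAdd (LOpp t) t) LZero
  | lie_scaleA a b t : lie_eq (LScale a (LScale b t)) (LScale (a * b) t)
  | lie_scale1 t : lie_eq (LScale 1 t) t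
  | lie_scaleDr a s t :
      lie_eq (LScale a (LAdd s t)) (LAdd (LScale a s) (LScale a t))
  | lie_scaleDl a b t :
      lie_eq (LScale (a + b) t) (LAdd (LScale a t) (LScale b t))
  | lie_bracketl a s t u :
      lie_eq (LBracket (LAdd (LScale a s) t) u)
             (LAdd (LScale a (LBracket s u)) (LBracket t u))
  | lie_bracketr a s t u :
      lie_eq (LBracket u (LAdd (LScale a s) t))
             (LAdd (LScale a (LBracket u s)) (LBracket u t))
  | lie_bracketxx t : lie_eq (LBracket t t) LZero
  | lie_jacobi s t u :
      lie_eq (LAdd (LAdd (LBracket s (LBracket t u))
                         (LBracket t (LBracket u s)))
                   (LBracket u (LBracket s t))) LZero
  | lie_rel t : rel t -> lie_eq t LZero.

HB.instance Definition _ := gen_eqMixin lie_term.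
HB.instance Definition _ := gen_choiceMixin lie_term.

Definition lie_eqb (s t : lie_term) : bool := `[< lie_eq s t >].

Lemma lie_eqb_equiv : equiv_class_of lie_eqb.
Proof.
split=> [t|s t|t s u].
- by apply/asboolP; exact: lie_refl.
- by apply/asboolP/asboolP; exact: lie_sym.
- by move=> /asboolP h1 /asboolP h2; apply/asboolP; exact: lie_trans h1 h2.
Qed.

Canonical lie_eqb_equiv_rel := EquivRelPack lie_eqb_equiv.
Canonical lie_eqb_encModRel := defaultEncModRel lie_eqb.

Definition presented_lie : Type := {eq_quot lie_eqb}%qT.
HB.instance Definition _ : EqQuotient lie_term lie_eqb presented_lie :=
  EqQuotient.on presented_lie.
HB.instance Definition _ := Choice.on presented_lie.

Definition lie_class (t : lie_term) : presented_lie := \pi_(presented_lie)%qT t.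

Lemma lie_class_eqP s t : lie_class s = lie_class t <-> lie_eq s t.
Proof.
split=> [h|h]; last by apply/eqmodP/asboolP.
by apply/asboolP; move/eqmodP: h.
Qed.

Lemma lie_repr t : lie_eq (repr (lie_class t)) t.
Proof. by apply/lie_class_eqP; rewrite /lie_class reprK. Qed.

Lemma lie_classP (P : presented_lie -> Prop) :
  (forall t, P (lie_class t)) -> forall x, P x.
Proof. by move=> h x; rewrite -[x]reprK; exact: h. Qed.

Let opp (x : presented_lie) := lie_class (LOpp (repr x)).
Let add (x y : presented_lie) := lie_class (LAdd (repr x) (repr y)).
Let scale a (x : presented_lie) := lie_class (LScale a (repr x)).
Let br (x y : presented_lie) := lie_class (LBracket (repr x) (repr y)).

Let oppE t : opp (lie_class t) = lie_class (LOpp t).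
Proof. by apply/lie_class_eqP/lie_congN/lie_repr. Qed.
Let addE s t : add (lie_class s) (lie_class t) = lie_class (LAdd s t).
Proof. by apply/lie_class_eqP/lie_congD; exact: lie_repr. Qed.
Let scaleE a t : scale a (lie_class t) = lie_class (LScale a t).
Proof. by apply/lie_class_eqP/lie_congZ/lie_repr. Qed.
Let brE s t : br (lie_class s) (lie_class t) = lie_class (LBracket s t).
Proof. by apply/lie_class_eqP/lie_congB; exact: lie_repr. Qed.

Let addA : associative add.
Proof.
elim/lie_classP=> s; elim/lie_classP=> t; elim/lie_classP=> u.
by rewrite !addE; apply/lie_class_eqP/lie_addA.
Qed.
Let addC : commutative add.
Proof.
elim/lie_classP=> s; elim/lie_classP=> t.
by rewrite !addE; apply/lie_class_eqP/lie_addC.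
Qed.
Let add0 : left_id (lie_class LZero) add.
Proof. by elim/lie_classP=> s; rewrite addE; apply/lie_class_eqP/lie_add0. Qed.
Let addN : left_inverse (lie_class LZero) opp add.
Proof.
by elim/lie_classP=> s; rewrite oppE addE; apply/lie_class_eqP/lie_addN.
Qed.

HB.instance Definition _ :=
  GRing.isZmodule.Build presented_lie addA addC add0 addN.

Let scaleA a b x : scale a (scale b x) = scale (a * b) x.
Proof.
elim/lie_classP: x => t.
by rewrite !scaleE; apply/lie_class_eqP/lie_scaleA.
Qed.
Let scale1 : left_id 1 scale.
Proof.
by elim/lie_classP=> t; rewrite scaleE; apply/lie_class_eqP/lie_scale1.
Qed.
Let scaleDr : right_distributive scale add.
Proof.
move=> a; elim/lie_classP=> s; elim/lie_classP=> t.
by rewrite !(addE, scaleE); apply/lie_class_eqP/lie_scaleDr.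
Qed.
Let scaleDl x a b : scale (a + b) x = add (scale a x) (scale b x).
Proof.
elim/lie_classP: x => t.
by rewrite !(addE, scaleE); apply/lie_class_eqP/lie_scaleDl.
Qed.

HB.instance Definition _ :=
  GRing.Zmodule_isLmodule.Build K presented_lie scaleA scale1 scaleDr scaleDl.

Lemma lie_classD s t : lie_class s + lie_class t = lie_class (LAdd s t).
Proof. exact: addE. Qed.
Lemma lie_classN t : - lie_class t = lie_class (LOpp t).
Proof. exact: oppE. Qed.
Lemma lie_classZ a t : a *: lie_class t = lie_class (LScale a t).
Proof. exact: scaleE. Qed.

Let br_linearl a x y z : br (a *: x + y) z = a *: br x z + br y z.
Proof.
elim/lie_classP: x => s; elim/lie_classP: y => t; elim/lie_classP: z => u.
rewrite lie_classZ lie_classD !brE lie_classZ lie_classD.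
exact/lie_class_eqP/lie_bracketl.
Qed.
Let br_linearr a x y z : br z (a *: x + y) = a *: br z x + br z y.
Proof.
elim/lie_classP: x => s; elim/lie_classP: y => t; elim/lie_classP: z => u.
rewrite lie_classZ lie_classD !brE lie_classZ lie_classD.
exact/lie_class_eqP/lie_bracketr.
Qed.
Let brxx x : br x x = 0.
Proof.
by elim/lie_classP: x => t; rewrite brE; apply/lie_class_eqP/lie_bracketxx.
Qed.
Let br_jacobi x y z : br x (br y z) + br y (br z x) + br z (br x y) = 0.
Proof.
elim/lie_classP: x => s; elim/lie_classP: y => t; elim/lie_classP: z => u.
rewrite !brE !lie_classD.
exact/lie_class_eqP/lie_jacobi.
Qed.

HB.instance Definition _ := Lmodule_isLieAlgebra.Build K presented_lie
  br_linearl br_linearr brxx br_jacobi.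

Lemma lie_classB s t :
  bracket (lie_class s) (lie_class t) = lie_class (LBracket s t).
Proof. exact: brE. Qed.

End Presentation.

(* The Kac-Moody Lie algebra of A, presented by Chevalley generators and Serre
   relations. *)
Section KacMoody.
Variables (K : fieldType) (n : nat) (A : 'M[int]_n).

Inductive chevalley : Type := Gh of 'I_n | Ge of 'I_n | Gf of 'I_n.

Local Notation term := (lie_term K chevalley).
Local Notation th i := (LGen K (Gh i)).
Local Notation te i := (LGen K (Ge i)).
Local Notation tf i := (LGen K (Gf i)).
Local Notation tsub s t := (LAdd s (LOpp t)).

Definition serre_exp (i j : 'I_n) : nat := `|1 - A i j|%N.

Inductive kac_moody_rel : term -> Prop :=
  | rel_hh i j : kac_moody_rel (LBracket (th i) (th j))
  | rel_he i j :
      kac_moody_rel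
        (tsub (LBracket (th i) (te j)) (LScale (A i j)%:~R (te j)))
  | rel_hf i j :
      kac_moody_rel
        (tsub (LBracket (th i) (tf j)) (LScale (- (A i j)%:~R) (tf j)))
  | rel_ef i j :
      kac_moody_rel
        (tsub (LBracket (te i) (tf j)) (LScale (i == j)%:R (th i)))
  | rel_serre_e i j : i != j ->
      kac_moody_rel (iter (serre_exp i j) (LBracket (te i)) (te j))
  | rel_serre_f i j : i != j ->
      kac_moody_rel (iter (serre_exp i j) (LBracket (tf i)) (tf j)).

Definition kac_moody : lieAlgType K := presented_lie kac_moody_rel.

Definition km_h (i : 'I_n) : kac_moody := lie_class kac_moody_rel (th i).
Definition km_e (i : 'I_n) : kac_moody := lie_class kac_moody_rel (te i).
Definition km_f (i : 'I_n) : kac_moody := lie_class kac_moody_rel (tf i).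

End KacMoody.

Section Subspaces.
Variables (K : fieldType) (M : lmodType K).

Definition is_subspace (V : set M) : Prop :=
  V 0 /\ forall (a : K) (u v : M), V u -> V v -> V (a *: u + v).

Definition subspace_sum (I : eqType) (D : set I) (U : I -> set M) : set M :=
  [set v | exists (s : seq I) (x : I -> M),
    [/\ uniq s, forall i, i \in s -> D i /\ U i (x i)
      & v = \sum_(i <- s) x i]].

Definition independent_family (I : eqType) (D : set I) (U : I -> set M) : Prop :=
  forall (s : seq I) (x : I -> M),
    uniq s -> (forall i, i \in s -> D i /\ U i (x i)) ->
    \sum_(i <- s) x i = 0 -> forall i, i \in s -> x i = 0.

Definition is_direct_sum (V : set M) (I : eqType) (D : set I)
    (U : I -> set M) : Prop :=
  V = subspace_sum D U /\ independent_family D U.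

Definition locally_nilpotent (V : set M) (f : M -> M) : Prop :=
  forall v, V v -> exists n : nat, iter n f v = 0.

End Subspaces.

Section LieModules.
Variables (K : fieldType) (L : lieAlgType K).

Definition is_lie_subalgebra (S : set L) : Prop :=
  is_subspace S /\ forall x y, S x -> S y -> S (bracket x y).

(* The subspace V of M is a module over the subalgebra S of L, for the action
   act restricted to S and V. *)
Definition is_lie_module (S : set L) (M : lmodType K) (V : set M)
    (act : L -> M -> M) : Prop :=
  [/\ is_subspace V,
      forall x v, S x -> V v -> V (act x v),
      forall a x y v, S x -> S y -> V v ->
        act (a *: x + y) v = a *: act x v + act y v,
      forall a x u v, S x -> V u -> V v ->
        act x (a *: u + v) = a *: act x u + act x v
    & forall x y v, S x -> S y -> V v ->
        act (bracket x y) v = act x (act y v) - act y (act x v)].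

End LieModules.

Definition i1 : 'I_3 := @Ordinal 3 0 isT.
Definition i2 : 'I_3 := @Ordinal 3 1 isT.
Definition i3 : 'I_3 := @Ordinal 3 2 isT.

Definition cartanA : 'M[int]_3 :=
  \matrix_(i, j) nth 0 (nth [::] [:: [::  2; -2;  0];
                                     [:: -2;  2; -1];
                                     [::  0; -1;  2]] i) j.

Section Feingold.
Variable R : realType.
Local Notation C := R[i].

Definition KMF : lieAlgType C := kac_moody C cartanA.

Definition h_ (i : 'I_3) : KMF := km_h C cartanA i.
Definition e_ (i : 'I_3) : KMF := km_e C cartanA i.
Definition f_ (i : 'I_3) : KMF := km_f C cartanA i.

(* Elements of the Cartan subalgebra are given by their coordinates in the
   basis (h_i); cartan_incl is the inclusion in KMF. *)
Definition hcartan : Type := 'rV[C]_3.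
Definition cartan_incl (H : hcartan) : KMF := \sum_i H 0 i *: h_ i.
Definition hc (i : 'I_3) : hcartan := delta_mx 0 i.

(* Elements of the dual of the Cartan subalgebra are given by their coordinates
   in the simple roots, a basis since det A = -2 is nonzero; weval mu H is
   mu(H), with alpha_j(h_i) = a_ij. *)
Definition hdual : Type := 'rV[C]_3.
Definition alpha (j : 'I_3) : hdual := delta_mx 0 j.
Definition weval (mu : hdual) (H : hcartan) : C :=
  \sum_i \sum_j H 0 i * (cartanA i j)%:~R * mu 0 j.

Definition hdualR : set hdual := [set mu | forall j, mu 0 j \is Num.real].

Definition bform (mu nu : hdual) : C :=
  \sum_i \sum_j mu 0 i * (cartanA i j)%:~R * nu 0 j.

Definition coform (a mu : hdual) : C := 2 * bform a mu / bform a a.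

Definition root_space (a : hdual) : set KMF :=
  [set x | forall H : hcartan, bracket (cartan_incl H) x = weval a H *: x].

Definition Phi : set hdual :=
  [set a | a <> 0 /\ exists2 x, root_space a x & x <> 0].

Definition Pwt : set hdual :=
  [set w | forall j, exists z : int, coform (alpha j) w = z%:~R].
Definition Pplus : set hdual :=
  [set w | Pwt w /\ forall j, 0 <= coform (alpha j) w].
Definition Pminus : set hdual := [set - w | w in Pplus].

Definition e1123 : KMF :=
  bracket (e_ i1) (bracket (e_ i1) (bracket (e_ i2) (e_ i3))).
Definition f1123 : KMF :=
  bracket (f_ i1) (bracket (f_ i1) (bracket (f_ i2) (f_ i3))).

(* In families over 'I_2, the indices 1, 2 are 0, 1, and 3 - i is rev_ord i. *)
Definition pair2 (T : Type) (x y : T) (i : 'I_2) : T := if i == 0 then x else y.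

Definition beta : 'I_2 -> hdual :=
  pair2 (2 *: alpha i1 + alpha i2 + alpha i3) (alpha i2).
Definition E_ : 'I_2 -> KMF := pair2 (2^-1 *: e1123) (e_ i2).
Definition F_ : 'I_2 -> KMF := pair2 (- (2^-1 *: f1123)) (f_ i2).
Definition H_ : 'I_2 -> hcartan := pair2 (2 *: hc i1 + hc i2 + hc i3) (hc i2).

Definition Fib : set KMF :=
  smallest (@is_lie_subalgebra C KMF)
    [set x | exists i, x = E_ i \/ x = F_ i \/ x = cartan_incl (H_ i)].

Definition cartanFib : set hcartan :=
  [set H | exists c : 'I_2 -> C, H = \sum_i c i *: H_ i].

(* The dual of cartanFib is identified with the span of beta_1 and beta_2. *)
Definition dualFib : set hdual :=
  [set mu | exists c : 'I_2 -> C, mu = \sum_i c i *: beta i].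

Definition dualFibR : set hdual :=
  [set mu | exists2 c : 'I_2 -> C,
     forall i, c i \is Num.real & mu = \sum_i c i *: beta i].

Definition lambda : 'I_2 -> hdual :=
  pair2 (- (5^-1 *: (2 *: beta 0 + 3 *: beta 1)))
        (- (5^-1 *: (3 *: beta 0 + 2 *: beta 1))).

Definition PFibplus : set hdual :=
  [set mu | exists k : 'I_2 -> nat, mu = \sum_i (k i)%:R *: lambda i].
Definition PFibminus : set hdual := [set - mu | mu in PFibplus].

Definition reflFib (i : 'I_2) (mu : hdual) : hdual :=
  mu - coform (beta i) mu *: beta i.

(* Each reflFib i is an involution, so words in the generators exhaust the
   group they generate. *)
Definition WFib : set (hdual -> hdual) :=
  [set w | exists s : seq 'I_2, w = fun mu => foldr reflFib mu s].

Definition WFib_invariant (S : set hdual) : Prop :=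
  forall w, WFib w -> w @` S = S.

Definition betaperp (i : 'I_2) : set hdual :=
  [set mu | hdualR mu /\ bform mu (beta i) = 0].

Definition Delta (m : int) : set hdual :=
  [set b | (Phi b \/ b = 0) /\ 2 * b 0 i3 - b 0 i1 = m%:~R].

Definition FibLevel (m : int) : set KMF := subspace_sum (Delta m) root_space.

(* The formula also makes sense on all of hdual; the projection is considered
   on hdualR. *)
Definition projFib (mu : hdual) : hdual := \sum_i weval mu (H_ i) *: lambda i.

Section FibModules.
Variables (M : lmodType C) (V : set M) (act : KMF -> M -> M).

Definition weight_space (mu : hdual) : set M :=
  [set v | V v /\
     forall H, cartanFib H -> act (cartan_incl H) v = weval mu H *: v].

Definition weights : set hdual :=
  [set mu | dualFib mu /\ exists2 v, weight_space mu v & v <> 0].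

Definition hFib_diagonalizable : Prop := is_direct_sum V dualFib weight_space.

Definition Fib_integrable : Prop :=
  hFib_diagonalizable /\
  forall i, locally_nilpotent V (act (E_ i)) /\
            locally_nilpotent V (act (F_ i)).

End FibModules.
End Feingold.

Arguments is_lie_module {K L} S M V act.
Arguments weight_space {R} M V act mu.
Arguments weights {R} M V act.
Arguments hFib_diagonalizable {R} M V act.
Arguments Fib_integrable {R} M V act.
Arguments Fib R : clear implicits.
Arguments FibLevel R m : clear implicits.
Arguments Delta R m : clear implicits.
Arguments projFib R mu : clear implicits.
Arguments Pplus R : clear implicits.
Arguments Pminus R : clear implicits.
Arguments PFibplus R : clear implicits.
Arguments PFibminus R : clear implicits.
Arguments betaperp R i : clear implicits.
Arguments dualFibR R : clear implicits.

(* Main.v *)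
Require Import Defs.
From HB Require Import structures.
From mathcomp Require Import all_boot all_order all_algebra.
From mathcomp Require Import complex boolp classical_sets reals.
From mathcomp Require Import ring.
Set Implicit Arguments.
Unset Strict Implicit.
Unset Printing Implicit Defensive.
Import Order.TTheory GRing.Theory Num.Theory.
Local Open Scope classical_set_scope.
Local Open Scope ring_scope.

(** Everything concerns the adjoint action of the subalgebra Fib on the
sums FibLevel m of root spaces.  The elements E_ i, F_ i, H_ i have level 0,
so Fib preserves the level, and a root vector for b is a weight vector for
projFib b because projFib b and b agree on H_ 0 and H_ 1.  This gives the
module structure, the diagonalization (eigenvectors for different weights are
independent) and the upper bound for the set of weights; the claims on
projections are computations in coordinates.  Three points need more.

Integrability.  The Serre relations make the Chevalley generators locally
ad-nilpotent ([ad_nilpotent_km_e]), but E_ 0 and F_ 0 are multiples of iterated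
brackets.  Local nilpotency is inherited by such a bracket for a general
reason: if D denotes the commutator with an operator X and D^(d+1) a = 0, then
D^(nd) (a^n) is a positive multiple of (D^d a)^n.  Expanding the left-hand side
into products X^k a^n X^j shows that it kills any given vector once n is large
([locally_nilpotent_commutator]).  Apply this with X = ad e_2, a = ad e_3,
d = 1, and then with X = ad e_1, a = ad [e_2, e_3], d = 2.

Invariance under the reflections.  The triple E_ i, H_ i, F_ i satisfies the
sl2 relations ([bracket_E_F]) and acts locally nilpotently.  Hence a nonzero
vector of H_ i-weight k has k an integer, and the k-th power of F_ i (or the
power -k of E_ i) does not kill it ([sl2_reflection]); this carries a root
vector for b to one for its reflection.

Nonvanishing.  The weight 0 belongs to Delta R 0 by convention, so it has to be
a weight of FibLevel R 0, which means that the algebra given by generators and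
relations is not zero.  [km_h_neq0] shows this for every generalized Cartan
matrix by letting the generators act on functions on words, the dual of
a Verma module whose highest weight takes the value 1 on every h_i.  There the Serre elements in the
f_i act by zero, and those in the e_i act by zero on the submodule generated
by the vacuum, both because a Serre element commutes with the generators of
the opposite sign ([serre_commutes]). *)

(** * Lie brackets *)

Section LieGeneralities.
Variables (K : fieldType) (L : lieAlgType K).
Implicit Types x y z : L.

Lemma bracketDr x y z : bracket x (y + z) = bracket x y + bracket x z.
Proof. by have := bracket_linearr 1 y z x; rewrite !scale1r. Qed.

Lemma bracket0r x : bracket x 0 = 0.
Proof. by apply: (addrI (bracket x 0)); rewrite -bracketDr !addr0. Qed.

Lemma bracketZr a x y : bracket x (a *: y) = a *: bracket x y.
Proof. by have := bracket_linearr a y 0 x; rewrite bracket0r !addr0. Qed.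

Lemma bracketNr x y : bracket x (- y) = - bracket x y.
Proof. by rewrite -scaleN1r bracketZr scaleN1r. Qed.

Lemma bracketDl x y z : bracket (x + y) z = bracket x z + bracket y z.
Proof. by have := bracket_linearl 1 x y z; rewrite !scale1r. Qed.

Lemma bracketC x y : bracket x y = - bracket y x.
Proof.
have := bracketxx (x + y); rewrite bracketDl !bracketDr !bracketxx add0r addr0.
by move=> /eqP; rewrite addr_eq0 => /eqP.
Qed.

Lemma bracketZl a x y : bracket (a *: x) y = a *: bracket x y.
Proof. by rewrite bracketC bracketZr [bracket y x]bracketC scalerN opprK. Qed.

Lemma bracket0l y : bracket 0 y = 0.
Proof. by rewrite bracketC bracket0r oppr0. Qed.

Lemma bracketNl x y : bracket (- x) y = - bracket x y.
Proof. by rewrite -scaleN1r bracketZl scaleN1r. Qed.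

Lemma bracket_suml (I : Type) (s : seq I) (F : I -> L) y :
  bracket (\sum_(i <- s) F i) y = \sum_(i <- s) bracket (F i) y.
Proof.
elim: s => [|i s IH]; first by rewrite !big_nil bracket0l.
by rewrite !big_cons bracketDl IH.
Qed.

Lemma bracket_derivation x y z :
  bracket x (bracket y z) = bracket (bracket x y) z + bracket y (bracket x z).
Proof.
have /eqP := bracket_jacobi x y z.
rewrite [bracket z (bracket x y)]bracketC [bracket z x]bracketC bracketNr.
by rewrite subr_eq0 => /eqP <-; rewrite addrNK.
Qed.

Lemma bracket_bracketl x y z :
  bracket (bracket x y) z = bracket x (bracket y z) - bracket y (bracket x z).
Proof. by rewrite bracket_derivation addrK. Qed.

Lemma bracket_additive x : zmod_morphism (bracket x).
Proof. by move=> u v; rewrite bracketDr bracketNr. Qed.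

Lemma iter_bracket0 x n : iter n (bracket x) 0 = 0.
Proof. by elim: n => //= n ->; rewrite bracket0r. Qed.

Lemma iter_bracketD x n y z :
  iter n (bracket x) (y + z) = iter n (bracket x) y + iter n (bracket x) z.
Proof. by elim: n => //= n ->; rewrite bracketDr. Qed.

Lemma iter_bracketZ x n a y :
  iter n (bracket x) (a *: y) = a *: iter n (bracket x) y.
Proof. by elim: n => //= n ->; rewrite bracketZr. Qed.

Lemma iter_bracket_geq x y m n : (m <= n)%N ->
  iter m (bracket x) y = 0 -> iter n (bracket x) y = 0.
Proof. by move=> mn h; rewrite -(subnK mn) iterD h iter_bracket0. Qed.

Lemma iter_ad_bracket p q x y z :
  iter p (bracket x) y = 0 -> iter q (bracket x) z = 0 ->
  iter (p + q) (bracket x) (bracket y z) = 0.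
Proof.
move: {2}(p + q)%N (erefl (p + q)%N) => n.
elim: n p q y z => [|n IH] p q y z hpq.
  move/eqP: hpq; rewrite addn_eq0 => /andP[/eqP-> /eqP->] /= -> _.
  by rewrite bracket0l.
case: p hpq => [|p] hpq hp; first by rewrite [y]hp bracket0l iter_bracket0.
case: q hpq => [|q] hpq hq.
  by rewrite [z]hq bracket0r iter_bracket0.
rewrite addSn iterSr bracket_derivation iter_bracketD.
rewrite IH ?add0r -?iterSr //; last by move: hpq; rewrite addSn => -[].
rewrite addnS -addSn; apply: IH; rewrite -?iterSr //.
by move: hpq; rewrite addSn addnS => -[].
Qed.

End LieGeneralities.

(** * Commutators of operators and local nilpotency *)

Section OperatorCommutator.
Variables (M : zmodType) (X : M -> M).
Hypothesis addX : zmod_morphism X.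
Implicit Types a b : M -> M.

Definition commutator a : M -> M := fun v => X (a v) - a (X v).

Lemma zmod_morphism_D a u v : zmod_morphism a -> a (u + v) = a u + a v.
Proof.
move=> ha; have h0 : a 0 = 0 by have := ha 0 0; rewrite !subrr.
have hN w : a (- w) = - a w by rewrite -[- w]add0r ha h0 add0r.
by rewrite -{1}[v]opprK ha hN opprK.
Qed.

Lemma zmod_morphism_0 a : zmod_morphism a -> a 0 = 0.
Proof. by move=> ha; have := ha 0 0; rewrite !subrr. Qed.

Lemma zmod_morphism_Mn a v n : zmod_morphism a -> a (v *+ n) = a v *+ n.
Proof.
move=> ha; elim: n => [|n IH]; first by rewrite !mulr0n zmod_morphism_0.
by rewrite !mulrS zmod_morphism_D // IH.
Qed.

Lemma commutator_additive a : zmod_morphism a -> zmod_morphism (commutator a).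
Proof.
by move=> ha u v; rewrite /commutator addX !ha addX !opprD addrACA.
Qed.

Lemma iter_commutator_additive m a :
  zmod_morphism a -> zmod_morphism (iter m commutator a).
Proof. by move=> ha; elim: m => //= m; exact: commutator_additive. Qed.

Lemma iter_commutatorD m a b v :
  iter m commutator (fun u => a u + b u) v =
    iter m commutator a v + iter m commutator b v.
Proof.
elim: m v => //= m IH v; rewrite /commutator !IH zmod_morphism_D //.
by rewrite opprD addrACA.
Qed.

Lemma iter_commutator0 m v : iter m commutator (fun=> 0) v = 0.
Proof. by elim: m v => //= m IH v; rewrite /commutator !IH zmod_morphism_0 // subrr. Qed.

Lemma commutator_comp a b : zmod_morphism a ->
  commutator (a \o b) = (fun v => commutator a (b v) + a (commutator b v)).
Proof.
move=> ha; apply/funext => v; rewrite /commutator /= ha.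
by rewrite addrA addrNK.
Qed.

(** The top-degree case of the Leibniz rule: every other term contains a power
of the derivation that kills one of the factors. *)
Lemma iter_commutator_comp p q a b v : zmod_morphism a ->
    iter p.+1 commutator a = (fun=> 0) -> iter q.+1 commutator b = (fun=> 0) ->
  iter (p + q) commutator (a \o b) v =
    iter p commutator a (iter q commutator b v) *+ 'C(p + q, p).
Proof.
move: {2}(p + q)%N (erefl (p + q)%N) => n.
elim: n p q a b v => [|n IH] p q a b v.
  by move/eqP; rewrite addn_eq0 => /andP[/eqP-> /eqP->].
have E m c d w : zmod_morphism c -> iter m.+1 commutator (c \o d) w =
    iter m commutator (commutator c \o d) w +
    iter m commutator (c \o commutator d) w.
  by move=> hc; rewrite iterSr commutator_comp // iter_commutatorD.
case: p q => [|p] [|q] // hpq ha hp hq.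
- rewrite add0n E // bin0 mulr1n.
  have -> : commutator a \o b = fun=> 0 by rewrite [commutator a]hp.
  rewrite iter_commutator0 add0r -[q in iter q]add0n IH //.
  + by rewrite bin0 mulr1n [in RHS]iterSr.
  + by move: hpq; rewrite add0n => -[].
  + by rewrite -iterSr.
- rewrite addn0 E // binn mulr1n.
  have -> : a \o commutator b = fun=> 0.
    by apply/funext => w /=; rewrite [commutator b]hq zmod_morphism_0.
  rewrite iter_commutator0 addr0 -[p in iter p]addn0 IH //.
  + by rewrite addn0 binn mulr1n [in RHS]iterSr.
  + by move: hpq; rewrite addn0 => -[<-]; rewrite addn0.
  + exact: commutator_additive.
  + by rewrite -iterSr.
- rewrite addSn E // addnS binS mulrnDr addrC; congr (_ + _).
    rewrite -addSn IH //.
    + by rewrite -iterSr.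
    + by move: hpq; rewrite !addSn addnS => -[].
    + by rewrite -iterSr.
  rewrite -addnS IH //.
  + by rewrite -iterSr.
  + by move: hpq; rewrite !addSn => -[].
  + exact: commutator_additive.
  + by rewrite -iterSr.
Qed.

Lemma iter_commutator_comp0 p q a b : zmod_morphism a -> zmod_morphism b ->
    iter p.+1 commutator a = (fun=> 0) -> iter q.+1 commutator b = (fun=> 0) ->
  iter (p + q).+1 commutator (a \o b) = (fun=> 0).
Proof.
move=> ha hb hp hq; apply/funext => v.
rewrite iterS /commutator !iter_commutator_comp // zmod_morphism_Mn // -mulrnBl.
have /(congr1 (fun f => f (iter q commutator b v))) := hp.
rewrite iterS {1}/commutator => /eqP; rewrite subr_eq0 => /eqP ->.
have /(congr1 (fun f => f v)) := hq.
rewrite iterS {1}/commutator => /eqP; rewrite subr_eq0 => /eqP ->.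
by rewrite subrr mul0rn.
Qed.

Lemma iter_additive n a : zmod_morphism a -> zmod_morphism (iter n a).
Proof. by move=> ha; elim: n => [|n IH] u v //=; rewrite IH ha. Qed.

(** The degree of a power is at most n * d, and its top-degree part is computed
by keeping, in every factor, the part of degree d. *)
Lemma iter_commutator_power d a : zmod_morphism a ->
    iter d.+1 commutator a = (fun=> 0) ->
  forall n, iter (n * d).+1 commutator (iter n a) = (fun=> 0) /\
    exists2 c, (0 < c)%N & forall v, iter (n * d) commutator (iter n a) v =
       iter n (iter d commutator a) v *+ c.
Proof.
move=> ha hd; elim=> [|n [IH0 [c c0 IH]]].
  split; last by exists 1%N => // v; rewrite mulr1n.
  by apply/funext => v /=; rewrite /commutator subrr.
rewrite mulSn (_ : iter n.+1 a = a \o iter n a) //; split.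
  by apply: iter_commutator_comp0 => //; exact: iter_additive.
exists (c * 'C(d + n * d, d))%N; first by rewrite muln_gt0 c0 bin_gt0 leq_addr.
move=> v; rewrite iter_commutator_comp // IH.
rewrite zmod_morphism_Mn ?mulrnA //; exact: iter_commutator_additive.
Qed.

(** The m-th commutator is a combination of the products X^k a X^j; the induction
on m avoids writing out the binomial coefficients. *)
Lemma iter_commutator_vanish m a v : (forall j, a (iter j X v) = 0) ->
  iter m commutator a v = 0.
Proof.
elim: m v => [|m IH] v h /=; first exact: (h 0%N).
rewrite /commutator IH // (zmod_morphism_0 addX) IH ?subrr // => j.
by rewrite -iterSr.
Qed.

End OperatorCommutator.

(** For large n the operator a^n kills the vectors X^j v, of which finitely many
are nonzero; hence its iterated commutators with X kill v, and one of them is a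
positive multiple of the n-th power of D^d a, with D = commutator X. *)
Lemma locally_nilpotent_commutator (K : numFieldType) (M : lmodType K)
    (X a : M -> M) d : zmod_morphism X -> zmod_morphism a ->
    iter d.+1 (commutator X) a = (fun=> 0) ->
    locally_nilpotent [set: M] X -> locally_nilpotent [set: M] a ->
  locally_nilpotent [set: M] (iter d (commutator X) a).
Proof.
move=> addX adda hd nX na v _.
have [m hm] := nX v I.
have iter0 k f : zmod_morphism f -> iter k f (0 : M) = 0.
  by move=> hf; exact/zmod_morphism_0/iter_additive.
have [n hn] : exists n, forall j, (j < m)%N -> iter n a (iter j X v) = 0.
  elim: m {hm} => [|m [n IH]]; first by exists 0%N.
  have [k hk] := na (iter m X v) I.
  exists (n + k)%N => j; rewrite ltnS leq_eqVlt => /orP[/eqP->|/IH].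
    by rewrite iterD hk iter0.
  by rewrite addnC iterD => ->; rewrite iter0.
exists n.
have [_ [c c0 /(_ v)]] := iter_commutator_power addX adda hd n.
rewrite iter_commutator_vanish // => [/esym/eqP|j].
  by rewrite -scaler_nat scaler_eq0 pnatr_eq0 -[c == _]negbK -lt0n c0 => /eqP.
have [|mj] := ltnP j m; first exact: hn.
by rewrite -(subnK mj) iterD hm !iter0 //; exact: iter_additive.
Qed.

(** * Locally ad-nilpotent elements *)

Section AdNilpotent.
Variables (K : numFieldType) (L : lieAlgType K).
Implicit Types x y z : L.

Definition ad_nilpotent x := locally_nilpotent [set: L] (bracket x).

Lemma commutator_bracket x y :
  commutator (bracket x) (bracket y) = bracket (bracket x y).
Proof. by apply/funext => v; rewrite /commutator bracket_bracketl. Qed.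

(** Taking ad turns brackets into commutators, so this is the statement for
operators read in the Lie algebra. *)
Lemma ad_nilpotent_iter x y d : ad_nilpotent x -> ad_nilpotent y ->
  iter d.+1 (bracket x) y = 0 -> ad_nilpotent (iter d (bracket x) y).
Proof.
move=> nx ny h.
have E m : iter m (commutator (bracket x)) (bracket y) =
    bracket (iter m (bracket x) y).
  by elim: m => //= m ->; rewrite commutator_bracket.
rewrite /ad_nilpotent -E; apply: locally_nilpotent_commutator => //.
- exact: bracket_additive.
- exact: bracket_additive.
- by rewrite E h; apply/funext => v; rewrite bracket0l.
Qed.

Lemma ad_nilpotentZ a x : ad_nilpotent x -> ad_nilpotent (a *: x).
Proof.
move=> nx v _; have [n hn] := nx v I; exists n.
have -> : iter n (bracket (a *: x)) v = a ^+ n *: iter n (bracket x) v.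
  elim: n {hn} => [|n IH]; first by rewrite scale1r.
  by rewrite !iterS IH bracketZl bracketZr scalerA exprS.
by rewrite hn scaler0.
Qed.

(** The two hypotheses on x1 give (ad x1)^3 [x2, x3] = [(ad x1)^3 x2, x3] = 0,
so the element is reached in two steps, of degrees 1 and 2. *)
Lemma ad_nilpotent_bracket_1123 x1 x2 x3 :
    ad_nilpotent x1 -> ad_nilpotent x2 -> ad_nilpotent x3 ->
    iter 3 (bracket x1) x2 = 0 -> bracket x1 x3 = 0 ->
    iter 2 (bracket x2) x3 = 0 ->
  ad_nilpotent (bracket x1 (bracket x1 (bracket x2 x3))).
Proof.
move=> n1 n2 n3 h12 h13 h23.
have n23 : ad_nilpotent (bracket x2 x3) by exact: (@ad_nilpotent_iter x2 x3 1).
apply: (@ad_nilpotent_iter x1 (bracket x2 x3) 2) => //=.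
have D y : bracket x1 (bracket y x3) = bracket (bracket x1 y) x3.
  by rewrite bracket_derivation h13 bracket0r addr0.
by rewrite !D [X in bracket X _]h12 bracket0l.
Qed.

End AdNilpotent.

(** * The sl2 argument for reflections *)

Section SL2.
Variables (K : numFieldType) (L : lieAlgType K) (e f h : L).
Hypotheses (ef : bracket e f = h) (he : bracket h e = 2 *: e)
  (hf : bracket h f = (- 2) *: f).
Implicit Types (x : L) (k : K).

Lemma sl2_weight_e x k n : bracket h x = k *: x ->
  bracket h (iter n (bracket e) x) = (k + n%:R *+ 2) *: iter n (bracket e) x.
Proof.
move=> hx; elim: n => [|n IH]; first by rewrite mul0rn addr0.
rewrite iterS bracket_derivation IH he bracketZl bracketZr -scalerDl.
by congr (_ *: _); rewrite -natr1; ring.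
Qed.

Lemma sl2_weight_f x k n : bracket h x = k *: x ->
  bracket h (iter n (bracket f) x) = (k - n%:R *+ 2) *: iter n (bracket f) x.
Proof.
move=> hx; elim: n => [|n IH]; first by rewrite mul0rn subr0.
rewrite iterS bracket_derivation IH hf bracketZl bracketZr -scalerDl.
by congr (_ *: _); rewrite -natr1; ring.
Qed.

Lemma sl2_commute_ef x k n : bracket h x = k *: x ->
  bracket e (iter n.+1 (bracket f) x) =
    iter n.+1 (bracket f) (bracket e x) +
    (n.+1%:R * (k - n%:R)) *: iter n (bracket f) x.
Proof.
move=> hx; elim: n => [|n IH].
  by rewrite /= bracket_derivation ef hx addrC mul1r subr0.
rewrite iterS bracket_derivation ef IH (sl2_weight_f _ hx).
rewrite bracketDr bracketZr -!iterS.
rewrite addrCA; congr (_ + _).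
by rewrite -scalerDl; congr (_ *: _); rewrite -!natr1; ring.
Qed.

(** In a highest weight vector of weight n the scalars (j + 1)(n - j), j < n, do
not vanish, so f^n cannot kill it.  The general case reduces to this one:
f^(n+2) kills e x when f^n kills x, by the commutation formula, so induction on
p shows e x = 0. *)
Lemma sl2_f_injective n p x : bracket h x = n%:R *: x ->
  iter p (bracket e) x = 0 -> iter n (bracket f) x = 0 -> x = 0.
Proof.
elim: p n x => [|p IH] n x hx //; rewrite iterSr => ep fn.
have e0 : bracket e x = 0.
  apply: (IH n.+2) => //.
    have := sl2_weight_e 1 hx; rewrite /= => ->.
    by congr (_ *: _); rewrite -!natr1; ring.
  have := sl2_commute_ef n.+1 hx; rewrite ![iter _.+1 _ x]iterS fn !bracket0r.
  by rewrite scaler0 addr0 => /esym.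
suff H j : (j <= n)%N -> iter j (bracket f) x = 0 -> x = 0 by exact: H fn.
elim: j => [|j IHj] // jn fj; apply: IHj; first exact: ltnW.
have := sl2_commute_ef j hx; rewrite fj e0 iter_bracket0 bracket0r add0r.
move/esym/eqP; rewrite scaler_eq0 mulf_eq0 pnatr_eq0 /= subr_eq0 eqr_nat.
by rewrite gtn_eqF // => /eqP.
Qed.

Lemma last_nonzero_iter (g : L -> L) x : x <> 0 ->
  (exists n, iter n g x = 0) -> exists n, iter n g x <> 0 /\ iter n.+1 g x = 0.
Proof.
move=> x0 [n]; elim: n => [//|n IH] hn.
by case: (pselect (iter n g x = 0)) => [/IH//|hn0]; exists n.
Qed.

(** Raise x to a highest weight vector, of weight k + 2p.  Lowering that vector
until it vanishes forces its weight to be a natural number n. *)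
Lemma sl2_weight_int x k : ad_nilpotent e -> ad_nilpotent f ->
  bracket h x = k *: x -> x <> 0 -> exists n p : nat, k = n%:R - p%:R *+ 2.
Proof.
move=> ne nf hx x0.
have [p [u0 eu]] := last_nonzero_iter x0 (ne x I).
have hu := sl2_weight_e p hx.
set u := iter p _ x in u0 hu; rewrite iterS -/u in eu.
have [n [v0 fv]] := last_nonzero_iter u0 (nf u I).
have := sl2_commute_ef n hu; rewrite fv eu iter_bracket0 bracket0r add0r.
move/esym/eqP; rewrite scaler_eq0 mulf_eq0 pnatr_eq0 /= subr_eq0.
move=> /orP[/eqP kn|/eqP//]; exists n, p.
by rewrite -kn addrK.
Qed.

End SL2.

(** Since k is an integer, it is a natural number or the opposite of one; the
second case is the first one for the triple (f, - h, e). *)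
Lemma sl2_reflection (K : numFieldType) (L : lieAlgType K) (e f h x : L) (k : K) :
    bracket e f = h -> bracket h e = 2 *: e -> bracket h f = (- 2) *: f ->
    ad_nilpotent e -> ad_nilpotent f -> bracket h x = k *: x -> x <> 0 ->
  exists n : nat, (k = n%:R /\ iter n (bracket f) x <> 0) \/
                  (k = - n%:R /\ iter n (bracket e) x <> 0).
Proof.
move=> ef he hf ne nf hx x0.
have [n [p kE]] := sl2_weight_int ef he hf ne nf hx x0.
case: (leqP (p * 2) n) => pn.
  exists (n - p * 2)%N; left.
  have kn : k = (n - p * 2)%:R by rewrite natrB // natrM kE mulr_natr.
  split=> // fx; have [q hq] := ne x I.
  by apply: x0; apply: (sl2_f_injective ef he hf _ hq fx); rewrite hx kn.
exists (p * 2 - n)%N; right.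
have kn : k = - (p * 2 - n)%:R.
  by rewrite natrB ?(ltnW pn) // natrM kE opprB mulr_natr.
split=> // fx; have [q hq] := nf x I; apply: x0.
apply: (@sl2_f_injective K L f e (- h) _ _ _ _ q x) => //.
- by rewrite bracketC ef.
- by rewrite bracketNl hf scaleNr opprK.
- by rewrite bracketNl he scaleNr.
- by rewrite bracketNl hx kn scaleNr opprK.
- by [].
Qed.

(** * Serre elements and generators of the opposite sign *)

Definition chevalley_relations (K : fieldType) (L : lieAlgType K) (n : nat)
    (A : 'M[int]_n) (h e f : 'I_n -> L) : Prop :=
  [/\ forall i j, bracket (h i) (h j) = 0,
      forall i j, bracket (h i) (e j) = (A i j)%:~R *: e j,
      forall i j, bracket (h i) (f j) = - (A i j)%:~R *: f j
    & forall i j, bracket (e i) (f j) = (i == j)%:R *: h i].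

Definition generalized_cartan (n : nat) (A : 'M[int]_n) : Prop :=
  [/\ forall i, A i i = 2, forall i j : 'I_n, i != j -> A i j <= 0
    & forall i j, A i j = 0 -> A j i = 0].

Section SerreCommutation.
Variables (K : fieldType) (L : lieAlgType K) (n : nat) (A : 'M[int]_n).
Hypothesis gcmA : generalized_cartan A.

Lemma serre_expE (i j : 'I_n) : i != j -> A i j = 1 - (serre_exp A i j)%:Z.
Proof.
move=> ij; case: gcmA => _ /(_ _ _ ij) Aij _.
by rewrite /serre_exp gez0_abs ?subKr // subr_ge0 (le_trans Aij).
Qed.

(** The Chevalley involution; it reduces the Serre elements in the f_i to those
in the e_i. *)
Lemma chevalley_relations_swap (h e f : 'I_n -> L) :
  chevalley_relations A h e f -> chevalley_relations A (fun i => - h i) f e.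
Proof.
case=> hh he hf ef; split=> i j.
- by rewrite bracketNl bracketNr hh !oppr0.
- by rewrite bracketNl hf scaleNr opprK.
- by rewrite bracketNl he scaleNr.
- rewrite bracketC ef eq_sym; case: eqP => [->|_]; first by rewrite !scale1r.
  by rewrite !scale0r oppr0.
Qed.

(** For k = i this is the sl2 computation
[f_i, (ad e_i)^(m+1) e_j] = - (m+1) (m + a_ij) (ad e_i)^m e_j, whose scalar
vanishes for m = - a_ij.  For k = j the bracket is (ad e_i)^(1 - a_ij) applied
to a multiple of h_j; it vanishes since [e_i, [e_i, h_j]] = 0 and, when
a_ij = 0, since a_ji = 0. *)
Lemma serre_commutes (h e f : 'I_n -> L) (i j k : 'I_n) : i != j ->
    chevalley_relations A h e f ->
  bracket (f k) (iter (serre_exp A i j) (bracket (e i)) (e j)) = 0.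
Proof.
move=> ij [hh he hf ef]; case: gcmA => Aii Ale0 Asym.
have fe a b : bracket (f a) (e b) = - ((a == b)%:R *: h a).
  rewrite bracketC ef eq_sym; case: eqP => [->//|_]; by rewrite !scale0r.
have wt m : bracket (h i) (iter m (bracket (e i)) (e j)) =
    (m%:R *+ 2 + (A i j)%:~R) *: iter m (bracket (e i)) (e j).
  elim: m => [|m IH]; first by rewrite mul0rn add0r /= he.
  rewrite iterS bracket_derivation he bracketZl IH bracketZr -scalerDl Aii.
  by congr (_ *: _); rewrite -natr1; ring.
have [ki|ki] := eqVneq k i.
  suff H m : bracket (f i) (iter m.+1 (bracket (e i)) (e j)) =
      (- (m.+1%:R * (m%:R + (A i j)%:~R))) *: iter m (bracket (e i)) (e j).
    have := serre_expE ij; case: (serre_exp A i j) => [|m] E.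
      by rewrite ki /= fe (negPf ij) scale0r oppr0.
    rewrite ki H -(_ : m%:Z%:~R = m%:R) // -intrD.
    rewrite (_ : m%:Z + A i j = 0) ?mulr0 ?oppr0 ?scale0r //.
    by rewrite E intS; ring.
  elim: m => [|m IH].
    rewrite /= bracket_derivation !fe eqxx (negPf ij) scale0r oppr0 bracket0r.
    by rewrite addr0 scale1r bracketNl he -scaleNr; congr (_ *: _); ring.
  rewrite iterS bracket_derivation fe eqxx scale1r bracketNl wt IH bracketZr.
  by rewrite -scaleNr -scalerDl; congr (_ *: _); rewrite -!natr1; ring.
have comm m y : bracket (f k) (iter m (bracket (e i)) y) =
    iter m (bracket (e i)) (bracket (f k) y).
  elim: m => //= m IH; rewrite bracket_derivation fe (negPf ki) scale0r oppr0.
  by rewrite bracket0l add0r IH.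
rewrite comm fe; have [kj|kj] := eqVneq k j; last first.
  by rewrite scale0r oppr0 iter_bracket0.
rewrite kj scale1r.
have eh : bracket (e i) (- h j) = (A j i)%:~R *: e i.
  by rewrite bracketNr bracketC opprK he.
have := serre_expE ij; case: (serre_exp A i j) => [|[|m]] E.
- by have := Ale0 _ _ ij; rewrite E.
- have /Asym A0 : A i j = 0 by rewrite E.
  by rewrite /= eh A0 scale0r.
- by rewrite !iterSr eh bracketZr bracketxx scaler0 iter_bracket0.
Qed.

End SerreCommutation.

(** * A module of functions on words *)

Section HighestWeightModule.
Variables (K : fieldType) (n : nat) (A : 'M[int]_n).
Local Notation term := (lie_term K (chevalley n)).
Local Notation state := (seq 'I_n -> K).
Local Notation th i := (LGen K (Gh i)).
Local Notation te i := (LGen K (Ge i)).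
Local Notation tf i := (LGen K (Gf i)).
Implicit Types (phi psi : state) (w : seq 'I_n).

(** The weight of the vector f_w v of a Verma module whose highest weight takes
the value 1 on every h_i. *)
Fixpoint word_weight (i : 'I_n) w : K :=
  if w is j :: w' then word_weight i w' - (A i j)%:~R else 1.

(** A state phi records the values vac (e_w phi) of all words in the raising
operators, where vac is the coefficient of the vacuum.  This dictates the
formulas for the generators: e_i prepends a letter, and f_i is found by moving
it to the left through e_w, where vac kills it. *)
Definition raise (i : 'I_n) phi : state := fun w => phi (i :: w).

Definition scale_by_weight (i : 'I_n) phi : state :=
  fun w => word_weight i w * phi w.

Fixpoint lower (i : 'I_n) phi w : K :=
  if w is j :: w' then
    lower i (raise j phi) w' + (i == j)%:R * scale_by_weight i phi w'
  else 0.

Definition lincomb a phi psi : state := fun w => a * phi w + psi w.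
Definition zero_state : state := fun=> 0.

Definition act_gen (x : chevalley n) : state -> state :=
  match x with
  | Gh i => scale_by_weight i
  | Ge i => raise i
  | Gf i => lower i
  end.

Fixpoint act (t : term) : state -> state :=
  match t with
  | LGen x => act_gen x
  | LZero => fun=> zero_state
  | LOpp s => fun phi w => - act s phi w
  | LAdd s t => fun phi w => act s phi w + act t phi w
  | LScale a s => fun phi w => a * act s phi w
  | LBracket s t => fun phi w => act s (act t phi) w - act t (act s phi) w
  end.

Lemma lower_linear i a phi psi w :
  lower i (lincomb a phi psi) w = a * lower i phi w + lower i psi w.
Proof.
elim: w phi psi => [|j w IH] phi psi /=; first by rewrite mulr0 addr0.
rewrite (_ : raise j _ = lincomb a (raise j phi) (raise j psi)) // IH.
by rewrite /scale_by_weight /lincomb; ring.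
Qed.

Lemma act_linear t a phi psi :
  act t (lincomb a phi psi) = lincomb a (act t phi) (act t psi).
Proof.
elim: t phi psi => [[i|i|i]||s IHs|s IHs t IHt|b s IHs|s IHs t IHt] phi psi;
  apply/funext => w; rewrite /= ?IHs ?IHt ?IHs ?lower_linear //;
  rewrite /scale_by_weight /zero_state /lincomb; ring.
Qed.

Lemma act0 t : act t zero_state = zero_state.
Proof.
have E : zero_state = lincomb (-1) zero_state zero_state.
  by apply/funext => w; rewrite /lincomb mulr0 addr0.
rewrite E act_linear; apply/funext => w; rewrite /lincomb /zero_state; ring.
Qed.

Definition state_submodule (N : state -> Prop) : Prop :=
  [/\ N zero_state, forall a phi psi, N phi -> N psi -> N (lincomb a phi psi)
    & forall x phi, N phi -> N (act_gen x phi)].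

Lemma submodule_act N t phi : state_submodule N -> N phi -> N (act t phi).
Proof.
case=> N0 Nlin Ngen.
elim: t phi => [x||s IHs|s IHs t IHt|b s IHs|s IHs t IHt] phi Nphi /=.
- exact: Ngen.
- exact: N0.
- rewrite (_ : (fun=> _) = lincomb (-1) (act s phi) zero_state).
    by apply: Nlin => //; exact: IHs.
  by apply/funext => w; rewrite /lincomb /zero_state; ring.
- rewrite (_ : (fun=> _) = lincomb 1 (act s phi) (act t phi)).
    by apply: Nlin; [exact: IHs | exact: IHt].
  by apply/funext => w; rewrite /lincomb; ring.
- rewrite (_ : (fun=> _) = lincomb b (act s phi) zero_state).
    by apply: Nlin => //; exact: IHs.
  by apply/funext => w; rewrite /lincomb /zero_state; ring.
- rewrite (_ : (fun=> _) =
      lincomb (-1) (act t (act s phi)) (act s (act t phi))).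
    by apply: Nlin; [exact/IHt/IHs | exact/IHs/IHt].
  by apply/funext => w; rewrite /lincomb; ring.
Qed.

(** Soundness of the presentation for the action on a submodule N on which the
defining relations hold.  Restricting to N matters because the Serre relations
in the e_i hold on the vacuum submodule only. *)
Lemma lie_eq_act (rel : term -> Prop) (N : state -> Prop) s t :
    state_submodule N ->
    (forall u phi, rel u -> N phi -> act u phi = zero_state) ->
    lie_eq rel s t -> forall phi, N phi -> act s phi = act t phi.
Proof.
move=> subN relN; have Nact u phi : N phi -> N (act u phi).
  exact: submodule_act.
have lin u a phi psi w : act u (fun v => a * phi v + psi v) w =
    a * act u phi w + act u psi w.
  exact: (congr1 (fun f => f w) (act_linear u a phi psi)).
elim=> {s t} /=; try (by move=> *; apply/funext => w; rewrite /zero_state; ring).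
- by move=> s t _ IH phi /IH.
- by move=> s t u _ IH1 _ IH2 phi Np; rewrite IH1 // IH2.
- by move=> s t _ IH phi /IH ->.
- by move=> s s' t t' _ IHs _ IHt phi Np; rewrite IHs // IHt.
- by move=> a s t _ IH phi /IH ->.
- move=> s s' t t' _ IHs _ IHt phi Np.
  by rewrite (IHs phi) // (IHt phi) // (IHs _ (Nact _ _ Np)) (IHt _ (Nact _ _ Np)).
- by move=> a s t u phi _; apply/funext => w; rewrite lin; ring.
- by move=> a s t u phi _; apply/funext => w; rewrite lin; ring.
- move=> s t u phi _; apply/funext => w; rewrite /zero_state.
  have linB v (p q : state) x : act v (fun y => p y - q y) x = act v p x - act v q x.
    rewrite (_ : (fun y => _) = lincomb (-1) q p) ?act_linear /lincomb; first by ring.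
    by apply/funext => y; ring.
  by rewrite !linB; ring.
- by move=> t /relN H phi /H.
Qed.

End HighestWeightModule.

(** * Nonvanishing of the Kac-Moody algebra *)

Section PresentedAlgebra.
Variables (K : fieldType) (n : nat) (A : 'M[int]_n).
Local Notation term := (lie_term K (chevalley n)).
Local Notation th i := (LGen K (Gh i)).
Local Notation te i := (LGen K (Ge i)).
Local Notation tf i := (LGen K (Gf i)).
Local Notation tsub s t := (LAdd s (LOpp t)).

(** The presentation without Serre relations: its algebra acts on all states, so
identities proved in it can be read as identities of operators. *)
Inductive chevalley_rel : term -> Prop :=
  | chevalley_hh i j : chevalley_rel (LBracket (th i) (th j))
  | chevalley_he i j :
      chevalley_rel
        (tsub (LBracket (th i) (te j)) (LScale (A i j)%:~R (te j)))
  | chevalley_hf i j :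
      chevalley_rel
        (tsub (LBracket (th i) (tf j)) (LScale (- (A i j)%:~R) (tf j)))
  | chevalley_ef i j :
      chevalley_rel
        (tsub (LBracket (te i) (tf j)) (LScale (i == j)%:R (th i))).

Lemma lie_class_rel (X : Type) (rel : lie_term K X -> Prop) t :
  rel t -> lie_class rel t = 0.
Proof. by move=> ?; apply/lie_class_eqP/lie_rel. Qed.

Lemma lie_class_rel_sub (X : Type) (rel : lie_term K X -> Prop) s t :
  rel (tsub s t) -> lie_class rel s = lie_class rel t.
Proof.
by move=> /lie_class_rel; rewrite -lie_classD -lie_classN => /subr0_eq.
Qed.

Lemma lie_class_iter (X : Type) (rel : lie_term K X -> Prop) m s t :
  lie_class rel (iter m (LBracket s) t) =
    iter m (bracket (lie_class rel s)) (lie_class rel t).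
Proof. by elim: m => //= m <-; rewrite lie_classB. Qed.

Lemma lie_class_chevalley (rel : term -> Prop) :
    (forall u, chevalley_rel u -> rel u) ->
  @chevalley_relations K (presented_lie rel) n A (fun i => lie_class rel (th i))
    (fun i => lie_class rel (te i)) (fun i => lie_class rel (tf i)).
Proof.
move=> sub; split=> i j; rewrite lie_classB ?lie_classZ.
- exact/lie_class_rel/sub/chevalley_hh.
- exact/lie_class_rel_sub/sub/chevalley_he.
- exact/lie_class_rel_sub/sub/chevalley_hf.
- exact/lie_class_rel_sub/sub/chevalley_ef.
Qed.

Lemma kac_moody_chevalley :
  chevalley_relations A (@km_h K n A) (@km_e K n A) (@km_f K n A).
Proof.
apply: lie_class_chevalley => _ [] *.
- exact: rel_hh.
- exact: rel_he.
- exact: rel_hf.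
- exact: rel_ef.
Qed.

Lemma kac_moody_serre_e (i j : 'I_n) : i != j ->
  iter (serre_exp A i j) (bracket (km_e K A i)) (km_e K A j) = 0.
Proof. by move=> ij; rewrite -lie_class_iter; apply/lie_class_rel/rel_serre_e. Qed.

Lemma kac_moody_serre_f (i j : 'I_n) : i != j ->
  iter (serre_exp A i j) (bracket (km_f K A i)) (km_f K A j) = 0.
Proof. by move=> ij; rewrite -lie_class_iter; apply/lie_class_rel/rel_serre_f. Qed.

Lemma kac_moody_ind (P : kac_moody K A -> Prop) :
    P 0 -> (forall a x y, P x -> P y -> P (a *: x + y)) ->
    (forall x y, P x -> P y -> P (bracket x y)) ->
    (forall i, P (km_h K A i)) -> (forall i, P (km_e K A i)) ->
    (forall i, P (km_f K A i)) ->
  forall x, P x.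
Proof.
move=> P0 Plin Pbr Ph Pe Pf; elim/lie_classP => t.
have PZ a x : P x -> P (a *: x) by move=> Px; rewrite -[_ *: _]addr0; exact: Plin.
elim: t => [[i|i|i]||s IH|s IHs t IHt|a s IH|s IHs t IHt] //.
- exact: Ph.
- exact: Pe.
- exact: Pf.
- by rewrite -lie_classN -scaleN1r; exact: PZ.
- by rewrite -lie_classD -[lie_class _ s]scale1r; exact: Plin.
- by rewrite -lie_classZ; exact: PZ.
- by rewrite -lie_classB; exact: Pbr.
Qed.

Lemma act_chevalley u (phi : seq 'I_n -> K) :
  chevalley_rel u -> act A u phi = @zero_state K n.
Proof.
case=> {u} i j; apply/funext => w; rewrite /= /zero_state.
- by rewrite /scale_by_weight; ring.
- by rewrite /raise /scale_by_weight /=; ring.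
- elim: w phi => [|k w IH] phi /=; rewrite /scale_by_weight /=; first by ring.
  have -> : raise k (fun v => word_weight K A i v * phi v) =
     lincomb (- (A i k)%:~R) (raise k phi) (scale_by_weight A i (raise k phi)).
    by apply/funext => v; rewrite /raise /lincomb /scale_by_weight /=; ring.
  rewrite lower_linear.
  have -> : lower A j (scale_by_weight A i (raise k phi)) w =
      (word_weight K A i w + (A i j)%:~R) * lower A j (raise k phi) w.
    apply/esym/eqP; rewrite -subr_eq0; apply/eqP.
    by rewrite -[RHS](IH (raise k phi)) /scale_by_weight; ring.
  rewrite /raise /= /scale_by_weight.
  by case: (eqVneq j k) => [->|_] /=; ring.
- by rewrite /raise /= [j == i]eq_sym; case: (eqVneq i j) => [->|_] /=; ring.
Qed.

Hypothesis gcmA : generalized_cartan A.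

Lemma act_commute s t (phi : seq 'I_n -> K) :
  bracket (lie_class chevalley_rel s) (lie_class chevalley_rel t) = 0 ->
  act A s (act A t phi) = act A t (act A s phi).
Proof.
rewrite lie_classB => /lie_class_eqP st; apply/funext => w; apply/eqP.
have /(congr1 (fun f => f w)) : act A (LBracket s t) phi = act A (LZero _ _) phi.
  apply: (@lie_eq_act _ _ _ chevalley_rel (fun=> True)) => // u psi + _.
  exact: act_chevalley.
by move=> /eqP; rewrite /= subr_eq0.
Qed.

Lemma act_serre_e (i j k : 'I_n) (phi : seq 'I_n -> K) : i != j ->
  let u := iter (serre_exp A i j) (LBracket (te i)) (te j) in
  act A u (lower A k phi) = lower A k (act A u phi).
Proof.
move=> ij u; apply: (act_commute (s := u) (t := tf k)).
rewrite bracketC lie_class_iter.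
have := @serre_commutes _ _ _ _ gcmA _ _ _ i j k ij
  (lie_class_chevalley (fun u (h : chevalley_rel u) => h)).
by move=> ->; rewrite oppr0.
Qed.

Lemma act_serre_f (i j k : 'I_n) (phi : seq 'I_n -> K) : i != j ->
  let u := iter (serre_exp A i j) (LBracket (tf i)) (tf j) in
  act A u (raise k phi) = raise k (act A u phi).
Proof.
move=> ij u; apply: (act_commute (s := u) (t := te k)).
rewrite bracketC lie_class_iter.
have := @serre_commutes _ _ _ _ gcmA _ _ _ i j k ij (chevalley_relations_swap
  (lie_class_chevalley (fun u (h : chevalley_rel u) => h))).
by move=> ->; rewrite oppr0.
Qed.

(** The value at the word w is the value at the empty word after applying e_w;
the Serre element commutes with e_w, and every f_i vanishes at the empty
word. *)
Lemma act_serre_f0 (i j : 'I_n) (phi : seq 'I_n -> K) : i != j ->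
  act A (iter (serre_exp A i j) (LBracket (tf i)) (tf j)) phi = @zero_state K n.
Proof.
move=> ij; apply/funext => w; elim: w phi => [|k w IH] phi.
  rewrite /zero_state; elim: (serre_exp A i j) phi => //= m IH phi.
  by rewrite IH subrr.
have /(congr1 (fun f => f w)) := act_serre_f k phi ij.
by rewrite IH => /esym.
Qed.

Definition vacuum (w : seq 'I_n) : K := (w == [::])%:R.

Inductive vacuum_submodule : (seq 'I_n -> K) -> Prop :=
  | vacuum_sub : vacuum_submodule vacuum
  | lower_sub i phi : vacuum_submodule phi -> vacuum_submodule (lower A i phi)
  | lincomb_sub a phi psi : vacuum_submodule phi -> vacuum_submodule psi ->
      vacuum_submodule (lincomb a phi psi).

(** Closure under f_i is built in; h_i and e_i are moved through the f's down to
the vacuum, an eigenvector of the h_i killed by the e_i. *)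
Lemma vacuum_submoduleP : state_submodule A vacuum_submodule.
Proof.
have N0 : vacuum_submodule (@zero_state K n).
  rewrite (_ : @zero_state K n = lincomb (-1) vacuum vacuum).
    by apply: lincomb_sub; exact: vacuum_sub.
  by apply/funext => w; rewrite /lincomb mulN1r addNr.
have rel u phi : chevalley_rel u -> act A u phi = @zero_state K n.
  exact: act_chevalley.
have Nh i phi : vacuum_submodule phi -> vacuum_submodule (scale_by_weight A i phi).
  elim=> {phi} [|j phi Nphi IH|a phi psi _ IH1 _ IH2].
  - rewrite (_ : scale_by_weight A i vacuum = vacuum); first exact: vacuum_sub.
    apply/funext => -[|k w]; rewrite /scale_by_weight /vacuum /= ?mulr1 ?mulr0 //.
  - rewrite (_ : scale_by_weight A i (lower A j phi) =
      lincomb (- (A i j)%:~R) (lower A j phi) (lower A j (scale_by_weight A i phi))).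
      by apply: lincomb_sub; exact: lower_sub.
    apply/funext => w; have /(congr1 (fun f => f w)) := rel _ phi (chevalley_hf i j).
    by rewrite /= /lincomb /zero_state => /eqP; rewrite subr_eq0 subr_eq => /eqP.
  - rewrite (_ : scale_by_weight A i _ =
        lincomb a (scale_by_weight A i phi) (scale_by_weight A i psi)).
      exact: lincomb_sub.
    by apply/funext => w; rewrite /lincomb /scale_by_weight; ring.
split=> [//|a phi psi|x phi]; first exact: lincomb_sub.
case: x => i; [exact: Nh| |exact: lower_sub].
rewrite [act_gen _ _]/=; elim=> {phi} [|j phi Nphi IH|a phi psi _ IH1 _ IH2].
- by rewrite (_ : raise i vacuum = @zero_state K n).
- rewrite (_ : raise i (lower A j phi) =
    lincomb (i == j)%:R (scale_by_weight A i phi) (lower A j (raise i phi))).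
    by apply: lincomb_sub; [exact: Nh | exact: lower_sub].
  apply/funext => w; have /(congr1 (fun f => f w)) := rel _ phi (chevalley_ef i j).
  by rewrite /= /lincomb /zero_state => /eqP; rewrite subr_eq0 subr_eq => /eqP.
- by apply: lincomb_sub.
Qed.

(** The Serre element commutes with the f_i, which generate the submodule from
the vacuum, and it kills the vacuum. *)
Lemma act_serre_e0 (i j : 'I_n) phi : i != j -> vacuum_submodule phi ->
  act A (iter (serre_exp A i j) (LBracket (te i)) (te j)) phi = @zero_state K n.
Proof.
move=> ij; elim=> {phi} [|k phi _ IH|a phi psi _ IH1 _ IH2].
- have e0 k : raise k vacuum = @zero_state K n by [].
  elim: (serre_exp A i j) => [|m IH] /=; first by rewrite e0.
  rewrite IH e0 act0; apply/funext => w; exact: subrr.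
- by rewrite act_serre_e // IH; exact: (act0 A (tf k)).
- rewrite act_linear IH1 IH2; apply/funext => w.
  by rewrite /lincomb /zero_state mulr0 addr0.
Qed.

(** The element h_i fixes the vacuum. *)
Theorem km_h_neq0 (i : 'I_n) : km_h K A i <> 0.
Proof.
move=> /lie_class_eqP hi0.
have /(congr1 (fun f => f [::])) :
    act A (th i) vacuum = act A (LZero _ _) vacuum.
  apply: (lie_eq_act vacuum_submoduleP _ hi0); last exact: vacuum_sub.
  move=> u phi; case=> {u}.
  - by move=> j k _; exact/act_chevalley/chevalley_hh.
  - by move=> j k _; exact/act_chevalley/chevalley_he.
  - by move=> j k _; exact/act_chevalley/chevalley_hf.
  - by move=> j k _; exact/act_chevalley/chevalley_ef.
  - by move=> j k jk; exact: act_serre_e0.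
  - by move=> j k jk _; exact: act_serre_f0.
by rewrite /= /scale_by_weight /zero_state /vacuum /= mulr1 => /eqP; rewrite oner_eq0.
Qed.

End PresentedAlgebra.

(** * Local nilpotency of the Chevalley generators *)

Section KacMoodyNilpotent.
Variables (K : numFieldType) (n : nat) (A : 'M[int]_n).
Local Notation L := (kac_moody K A).

(** As ad x is a derivation, the elements killed by some power of it form a
subalgebra. *)
Lemma ad_nilpotent_generators (x : L) :
    (forall i, exists m, iter m (bracket x) (km_h K A i) = 0) ->
    (forall i, exists m, iter m (bracket x) (km_e K A i) = 0) ->
    (forall i, exists m, iter m (bracket x) (km_f K A i) = 0) ->
  ad_nilpotent x.
Proof.
move=> nh ne nf v _; elim/kac_moody_ind: v => //.
- by exists 0%N.
- move=> a y z [p hp] [q hq]; exists (p + q)%N.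
  rewrite iter_bracketD iter_bracketZ (iter_bracket_geq (leq_addr q p)) //.
  by rewrite (iter_bracket_geq (leq_addl p q)) // scaler0 addr0.
- by move=> y z [p hp] [q hq]; exists (p + q)%N; exact: iter_ad_bracket.
Qed.

Lemma ad_nilpotent_km_e i : ad_nilpotent (km_e K A i).
Proof.
have [hh he hf ef] := kac_moody_chevalley K A.
apply: ad_nilpotent_generators => j.
- by exists 2; rewrite /= [bracket _ (km_h _ _ _)]bracketC he bracketNr bracketZr
    bracketxx scaler0 oppr0.
- have [->|ji] := eqVneq j i; first by exists 1%N; rewrite /= bracketxx.
  by exists (serre_exp A i j); apply: kac_moody_serre_e; rewrite eq_sym.
- exists 3; rewrite /= ef !bracketZr [bracket _ (km_h _ _ _)]bracketC he.
  by rewrite bracketNr bracketZr bracketxx !(scaler0, oppr0).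
Qed.

Lemma ad_nilpotent_km_f i : ad_nilpotent (km_f K A i).
Proof.
have [hh he hf ef] := kac_moody_chevalley K A.
apply: ad_nilpotent_generators => j.
- by exists 2; rewrite /= [bracket _ (km_h _ _ _)]bracketC hf bracketNr bracketZr
    bracketxx scaler0 oppr0.
- exists 3; rewrite /= [bracket (km_f _ _ _) (km_e _ _ _)]bracketC ef.
  rewrite !(bracketNr, bracketZr) [bracket _ (km_h _ _ _)]bracketC hf.
  by rewrite bracketNr bracketZr bracketxx !(scaler0, oppr0).
- have [->|ji] := eqVneq j i; first by exists 1%N; rewrite /= bracketxx.
  by exists (serre_exp A i j); apply: kac_moody_serre_f; rewrite eq_sym.
Qed.

End KacMoodyNilpotent.

(** * The algebra with Cartan matrix A *)

Lemma sum_ord3 (V : nmodType) (F : 'I_3 -> V) :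
  \sum_(i < 3) F i = F i1 + F i2 + F i3.
Proof.
rewrite !big_ord_recl big_ord0 addr0 addrA.
by congr (F _ + F _ + F _); apply/val_inj.
Qed.

Lemma sum_ord2 (V : nmodType) (F : 'I_2 -> V) : \sum_(i < 2) F i = F 0 + F 1.
Proof.
by rewrite !big_ord_recl big_ord0 addr0; congr (F _ + F _); apply/val_inj.
Qed.

Lemma ord3P (P : 'I_3 -> Prop) : P i1 -> P i2 -> P i3 -> forall i, P i.
Proof.
move=> h1 h2 h3 [[|[|[|//]]] hi].
- by rewrite (_ : Ordinal hi = i1) //; apply/val_inj.
- by rewrite (_ : Ordinal hi = i2) //; apply/val_inj.
- by rewrite (_ : Ordinal hi = i3) //; apply/val_inj.
Qed.

Lemma ord2P (P : 'I_2 -> Prop) : P 0 -> P 1 -> forall i, P i.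
Proof.
move=> h0 h1 [[|[|//]] hi].
- by rewrite (_ : Ordinal hi = 0) //; apply/val_inj.
- by rewrite (_ : Ordinal hi = 1) //; apply/val_inj.
Qed.

Lemma cartanA_gcm : generalized_cartan cartanA.
Proof.
split.
- by apply: ord3P; rewrite mxE.
- by apply: ord3P; apply: ord3P; rewrite mxE.
- by apply: ord3P; apply: ord3P; rewrite !mxE.
Qed.

(** The computation behind [E_1, F_1] = H_1.  The actions of e_1, e_2, e_3 on the
iterated brackets of the f_i are tabulated by increasing length; iterated
brackets of the e_i are then expanded as commutators. *)
Lemma bracket_e1123_f1123 (K : fieldType) (L : lieAlgType K) (h e f : 'I_3 -> L) :
    chevalley_relations cartanA h e f -> bracket (f i1) (f i3) = 0 ->
  bracket (bracket (e i1) (bracket (e i1) (bracket (e i2) (e i3))))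
          (bracket (f i1) (bracket (f i1) (bracket (f i2) (f i3)))) =
    - 4 *: (2 *: h i1 + h i2 + h i3).
Proof.
case=> hh he hf ef f13.
have e_f (i : 'I_3) : bracket (e i) (f i) = h i by rewrite ef eqxx scale1r.
have e_f0 (i j : 'I_3) : i != j -> bracket (e i) (f j) = 0.
  by move=> /negPf ij; rewrite ef ij scale0r.
have e1f23 : bracket (e i1) (bracket (f i2) (f i3)) = 0.
  by rewrite bracket_derivation !e_f0 // bracket0l bracket0r addr0.
have e2f23 : bracket (e i2) (bracket (f i2) (f i3)) = f i3.
  rewrite bracket_derivation e_f e_f0 // bracket0r addr0 hf mxE /=.
  by rewrite opprK scale1r.
have e3f23 : bracket (e i3) (bracket (f i2) (f i3)) = - f i2.
  rewrite bracket_derivation e_f e_f0 // bracket0l add0r bracketC hf mxE /=.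
  by rewrite opprK scale1r.
have h1f23 : bracket (h i1) (bracket (f i2) (f i3)) = 2 *: bracket (f i2) (f i3).
  rewrite bracket_derivation !hf !mxE /= bracketZl bracketZr -scalerDl.
  by congr (_ *: _); ring.
set f23 := bracket (f i2) (f i3) in e1f23 e2f23 e3f23 h1f23 *.
have e1f123 : bracket (e i1) (bracket (f i1) f23) = 2 *: f23.
  by rewrite bracket_derivation e_f e1f23 bracket0r addr0 h1f23.
have e2f123 : bracket (e i2) (bracket (f i1) f23) = 0.
  by rewrite bracket_derivation e_f0 // e2f23 bracket0l add0r f13.
have e3f123 : bracket (e i3) (bracket (f i1) f23) = - bracket (f i1) (f i2).
  by rewrite bracket_derivation e_f0 // e3f23 bracket0l add0r bracketNr.
have e1f1123 : bracket (e i1) (bracket (f i1) (bracket (f i1) f23)) =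
    2 *: bracket (f i1) f23.
  rewrite bracket_derivation e_f e1f123 bracket_derivation hf h1f23 mxE /=.
  rewrite bracketZl !bracketZr -!scalerDl; congr (_ *: _); ring.
have e2f1123 : bracket (e i2) (bracket (f i1) (bracket (f i1) f23)) = 0.
  by rewrite bracket_derivation e_f0 // e2f123 bracket0l bracket0r addr0.
have e3f1123 : bracket (e i3) (bracket (f i1) (bracket (f i1) f23)) =
    - bracket (f i1) (bracket (f i1) (f i2)).
  by rewrite bracket_derivation e_f0 // e3f123 bracket0l add0r bracketNr.
have e2f12 : bracket (e i2) (bracket (f i1) (f i2)) = - 2 *: f i1.
  rewrite bracket_derivation e_f0 // bracket0l add0r e_f bracketC hf mxE /=.
  by rewrite -scaleNr; congr (_ *: _); ring.
have e23f1123 : bracket (bracket (e i2) (e i3))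
    (bracket (f i1) (bracket (f i1) f23)) = 0.
  rewrite bracket_bracketl e3f1123 e2f1123 bracket0r subr0 bracketNr.
  rewrite bracket_derivation e2f12 e_f0 // bracket0l add0r bracketZr bracketxx.
  by rewrite scaler0 oppr0.
have e23f123 : bracket (bracket (e i2) (e i3)) (bracket (f i1) f23) = 2 *: f i1.
  rewrite bracket_bracketl e3f123 e2f123 bracket0r subr0 bracketNr e2f12.
  by rewrite scaleNr opprK.
have e23f23 : bracket (bracket (e i2) (e i3)) f23 = - (h i2 + h i3).
  by rewrite bracket_bracketl e3f23 e2f23 bracketNr !e_f opprD.
rewrite [LHS]bracket_bracketl e1f1123.
rewrite [bracket (bracket (e i1) _) (bracket (f i1) (bracket _ _))]bracket_bracketl.
rewrite e1f1123 e23f1123 bracket0r add0r !bracketZr e23f123.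
rewrite [bracket (bracket (e i1) _) _]bracket_bracketl e1f123 e23f123.
rewrite !(bracketZr, bracketNr) e_f e23f23.
rewrite !(scalerDr, scalerN, scalerA, opprD, opprK) -!scaleNr.
rewrite -!addrA [RHS]addrA !addrA -scalerDl.
by congr (_ *: _ + _ *: _ + _ *: _); ring.
Qed.

(** Stated over an abstract field, where the coordinates of matrices and
numerals simplify without unfolding complex numbers. *)
Lemma fundamental_coordinates (K : numFieldType) n (x y : 'rV[K]_n) :
  let l0 := - (5^-1 *: (2 *: x + 3 *: y)) in
  let l1 := - (5^-1 *: (3 *: x + 2 *: y)) in
  [/\ 2 *: l0 + (- 3) *: l1 = x, (- 3) *: l0 + 2 *: l1 = y
    & forall a b, a *: l0 + b *: l1 = - (5^-1 * (2 * a + 3 * b)) *: x +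
                                       - (5^-1 * (3 * a + 2 * b)) *: y].
Proof.
by split=> [||a b]; apply/rowP => j; rewrite !mxE; field.
Qed.

(** * Weights, projection and reflections *)

Section WeightCalculus.
Variable R : realType.
Local Notation C := R[i].
Implicit Types (mu nu : hdual R) (H : hcartan R).

Lemma bformE mu nu : bform mu nu =
  mu 0 i1 * (2 * nu 0 i1 - 2 * nu 0 i2) +
  mu 0 i2 * (2 * nu 0 i2 - 2 * nu 0 i1 - nu 0 i3) +
  mu 0 i3 * (2 * nu 0 i3 - nu 0 i2).
Proof. by rewrite /bform !sum_ord3 !mxE /=; ring. Qed.

Lemma bformDZl a mu mu' nu :
  bform (a *: mu + mu') nu = a * bform mu nu + bform mu' nu.
Proof. by rewrite !bformE !mxE; ring. Qed.

Lemma bformDZr a mu nu nu' :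
  bform mu (a *: nu + nu') = a * bform mu nu + bform mu nu'.
Proof. by rewrite !bformE !mxE; ring. Qed.

Lemma bformC mu nu : bform mu nu = bform nu mu.
Proof. by rewrite !bformE; ring. Qed.

Lemma bform0r mu : bform mu 0 = 0.
Proof. by rewrite bformE !mxE; ring. Qed.

Lemma bformZr a mu nu : bform mu (a *: nu) = a * bform mu nu.
Proof. by rewrite -[a *: nu]addr0 bformDZr bform0r addr0. Qed.

Lemma bformDr mu nu nu' : bform mu (nu + nu') = bform mu nu + bform mu nu'.
Proof. by rewrite -[nu]scale1r bformDZr mul1r scale1r. Qed.

Lemma bformNr mu nu : bform mu (- nu) = - bform mu nu.
Proof. by rewrite -scaleN1r bformZr mulN1r. Qed.

(** Coweights are written in the simple coroots and weights in the simple roots;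
A is the matrix of both pairings. *)
Lemma wevalE mu H : weval mu H = bform H mu.
Proof. by []. Qed.

Lemma weval_H mu i : weval mu (H_ R i) = bform (beta R i) mu.
Proof. by []. Qed.

Lemma bform_beta_beta i j :
  bform (beta R i) (beta R j) = if i == j then 2 else - 3.
Proof.
by move: i j; apply: ord2P; apply: ord2P; rewrite /beta /pair2 /= bformE !mxE /=; ring.
Qed.

Lemma bform_beta_lambda i j : bform (beta R i) (lambda R j) = (i == j)%:R.
Proof.
move: i j; apply: ord2P; apply: ord2P;
rewrite /lambda /beta /pair2 /= bformE !mxE /=; by field.
Qed.

Lemma coform_beta mu i : coform (beta R i) mu = bform (beta R i) mu.
Proof.
by rewrite /coform bform_beta_beta eqxx mulrAC mulfV ?mul1r // pnatr_eq0.
Qed.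

Lemma coform_alpha mu i : coform (alpha R i) mu = bform (alpha R i) mu.
Proof.
rewrite /coform; have -> : bform (alpha R i) (alpha R i) = 2.
  by move: i; apply: ord3P; rewrite bformE !mxE /=; ring.
by rewrite mulrAC mulfV ?mul1r // pnatr_eq0.
Qed.

Lemma projFib_linear a mu nu :
  projFib R (a *: mu + nu) = a *: projFib R mu + projFib R nu.
Proof.
rewrite /projFib scaler_sumr -big_split; apply: eq_bigr => i _.
by rewrite !weval_H bformDZr scalerDl scalerA.
Qed.

Lemma projFib0 : projFib R 0 = 0.
Proof.
by rewrite /projFib big1 // => i _; rewrite weval_H bform0r; exact: scale0r.
Qed.

Lemma projFibN mu : projFib R (- mu) = - projFib R mu.
Proof. by rewrite -scaleN1r -[_ *: mu]addr0 projFib_linear projFib0 addr0 scaleN1r. Qed.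

Lemma projFib_beta i : projFib R (beta R i) = beta R i.
Proof.
have [l0 l1 _] := fundamental_coordinates (beta R 0) (beta R 1).
rewrite /projFib sum_ord2 !weval_H !bform_beta_beta.
by move: i; apply: ord2P.
Qed.

Lemma projFib_id mu : dualFib mu -> projFib R mu = mu.
Proof.
case=> c ->; rewrite !sum_ord2 projFib_linear projFib_beta.
by rewrite -[c 1 *: _]addr0 projFib_linear projFib_beta projFib0.
Qed.

Lemma dualFib_proj mu : dualFib (projFib R mu).
Proof.
have [_ _ lE] := fundamental_coordinates (beta R 0) (beta R 1).
rewrite /projFib sum_ord2; set a := weval mu _; set b := weval mu _.
exists (pair2 (- (5^-1 * (2 * a + 3 * b))) (- (5^-1 * (3 * a + 2 * b)))).
by rewrite sum_ord2; exact: lE.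
Qed.

Lemma bform_beta_proj mu i : bform (beta R i) (projFib R mu) = bform (beta R i) mu.
Proof.
rewrite /projFib sum_ord2; have := bform_beta_lambda i.
move: (lambda R) => l lE; rewrite bformDr !bformZr !lE !weval_H.
by move: i {lE}; apply: ord2P; rewrite /= mulr1 mulr0 ?addr0 ?add0r.
Qed.

Lemma weval_projFib mu H : cartanFib H -> weval (projFib R mu) H = weval mu H.
Proof.
case=> c ->; rewrite !wevalE !sum_ord2.
have bformDl a a' b b' nu :
    bform (a *: b + a' *: b') nu = a * bform b nu + a' * bform b' nu.
  by rewrite bformDZl -[a' *: b']addr0 bformDZl [bform 0 _]bformC bform0r addr0.
rewrite [LHS]bformDl [RHS]bformDl.
congr (_ * _ + _ * _); first exact: (bform_beta_proj mu 0).
exact: (bform_beta_proj mu 1).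
Qed.

Lemma dualFib_separated mu nu : dualFib mu -> dualFib nu ->
  (forall i, weval mu (H_ R i) = weval nu (H_ R i)) -> mu = nu.
Proof.
move=> dmu dnu h; rewrite -(projFib_id dmu) -(projFib_id dnu) /projFib.
by apply: eq_bigr => i _; rewrite h.
Qed.

Lemma cartanFib_H i : cartanFib (H_ R i).
Proof.
exists (fun j => (j == i)%:R); rewrite (bigD1 i) //= eqxx scale1r big1 ?addr0 //.
by move=> j /negPf ->; exact: scale0r.
Qed.

Lemma reflFibE i mu : reflFib i mu = mu - bform (beta R i) mu *: beta R i.
Proof. by rewrite /reflFib coform_beta. Qed.

Lemma bform_reflFib i mu : bform (beta R i) (reflFib i mu) = - bform (beta R i) mu.
Proof. by rewrite reflFibE bformDr bformNr bformZr bform_beta_beta eqxx; ring. Qed.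

Lemma reflFibK i : involutive (@reflFib R i).
Proof.
move=> mu; rewrite reflFibE bform_reflFib reflFibE scaleNr opprK.
by rewrite addrNK.
Qed.

Lemma projFib_refl i mu : projFib R (reflFib i mu) = reflFib i (projFib R mu).
Proof.
rewrite !reflFibE bform_beta_proj -scaleNr addrC projFib_linear projFib_beta.
by rewrite addrC scaleNr.
Qed.

Lemma reflFib_level i mu :
  2 * (reflFib i mu) 0 i3 - (reflFib i mu) 0 i1 = 2 * mu 0 i3 - mu 0 i1.
Proof.
rewrite reflFibE; set c := bform _ _; move: i @c.
by apply: ord2P => c; rewrite /beta /pair2 /= !mxE /=; ring.
Qed.

Lemma WFib_invariantP (S : set (hdual R)) :
  (forall i mu, S mu -> S (reflFib i mu)) -> WFib_invariant S.
Proof.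
move=> hS w [s ->]; apply/seteqP; split=> [_ [mu Smu <-]|mu Smu].
  by elim: s => //= i s IH; exact: hS.
exists (foldr (@reflFib R) mu (rev s)).
  by elim/last_ind: s => //= s i IH; rewrite rev_rcons /=; exact: hS.
elim/last_ind: s => [|s i IH] //=.
by rewrite rev_rcons foldr_rcons /= reflFibK.
Qed.

End WeightCalculus.

(** * Sums of subspaces and eigenvectors *)

Section SubspaceSums.
Variables (K : fieldType) (M : lmodType K).

Lemma subspaceZ (V : set M) a v : is_subspace V -> V v -> V (a *: v).
Proof. by case=> V0 Vlin Vv; rewrite -[_ *: _]addr0; exact: Vlin. Qed.

Lemma subspaceD (V : set M) u v : is_subspace V -> V u -> V v -> V (u + v).
Proof. by case=> _ Vlin Vu Vv; rewrite -[u]scale1r; exact: Vlin. Qed.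

Lemma subspace_bigsum (V : set M) (I : eqType) (s : seq I) (x : I -> M) :
  is_subspace V -> (forall i, i \in s -> V (x i)) -> V (\sum_(i <- s) x i).
Proof.
move=> subV; elim: s => [|i s IH] Vx; first by rewrite big_nil; case: subV.
rewrite big_cons; apply: subspaceD => //; first exact/Vx/mem_head.
by apply: IH => j js; apply: Vx; rewrite inE js orbT.
Qed.

Variables (I : eqType) (D : set I) (U : I -> set M).

Lemma subspace_sum_in i x : D i -> U i x -> subspace_sum D U x.
Proof.
move=> Di Ux; exists [:: i], (fun=> x); split=> //.
  by move=> j; rewrite inE => /eqP ->.
by rewrite big_seq1.
Qed.

Lemma subspace_sum_sub (V : set M) : is_subspace V ->
  (forall i, D i -> U i `<=` V) -> subspace_sum D U `<=` V.
Proof.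
move=> subV UV _ [s [x [_ sx ->]]]; apply: subspace_bigsum => // i /sx[Di Ux].
exact: UV Ux.
Qed.

(** Two sums indexed by different sequences are added over the union of these,
after extension by zero. *)
Lemma subspace_sum_subspace : (forall i, is_subspace (U i)) ->
  is_subspace (subspace_sum D U).
Proof.
move=> subU; split; first by exists [::], (fun=> 0); rewrite big_nil.
move=> a _ _ [s [x [us sx ->]]] [t [y [ut ty ->]]].
pose ext (r : seq I) (z : I -> M) i := if i \in r then z i else 0.
have extE r z q : uniq q -> uniq r -> {subset r <= q} ->
    \sum_(i <- r) z i = \sum_(i <- q) ext r z i.
  move=> uq ur rq; rewrite /ext -big_mkcond /= -[RHS]big_filter.
  apply: perm_big; apply: uniq_perm; rewrite ?filter_uniq // => i.
  by rewrite mem_filter; case: (boolP (i \in r)) => // /rq ->.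
pose q := undup (s ++ t); exists q, (fun i => a *: ext s x i + ext t y i).
split; first exact: undup_uniq.
- move=> i; rewrite mem_undup mem_cat => /orP ist; split.
    by case: ist => [/sx[]|/ty[]].
  apply: subspaceD => //; first apply: subspaceZ => //; rewrite /ext.
    by case: ifP => [/sx[]//|_]; case: (subU i).
  by case: ifP => [/ty[]//|_]; case: (subU i).
rewrite big_split -scaler_sumr -!extE ?undup_uniq // => i ir;
by rewrite mem_undup mem_cat ir ?orbT.
Qed.

End SubspaceSums.

(** An eigenvector is not a sum of eigenvectors for other systems of eigenvalues;
repetitions among the latter are allowed.  If T_j separates the first summand
from v, then T_j minus its eigenvalue removes that summand and multiplies v by
a nonzero scalar. *)
Lemma eigenvector_sum_separated (K : fieldType) (M : lmodType K) (J : Type)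
    (I : eqType) (T : J -> M -> M) (s : seq I) (x : I -> M) (w : I -> J -> K)
    (v : M) (mu : J -> K) :
    (forall j a u u', T j (a *: u + u') = a *: T j u + T j u') ->
    (forall i j, i \in s -> T j (x i) = w i j *: x i) ->
    (forall j, T j v = mu j *: v) ->
    (forall i, i \in s -> exists j, w i j <> mu j) ->
  v = \sum_(i <- s) x i -> v = 0.
Proof.
move=> Tlin.
have T0 j : T j 0 = 0.
  by apply: (addrI (T j 0)); have := Tlin j 1 0 0; rewrite !scale1r !addr0.
have TZ j a u : T j (a *: u) = a *: T j u by rewrite -[_ *: u]addr0 Tlin T0 addr0.
have TD j u u' : T j (u + u') = T j u + T j u'.
  by have := Tlin j 1 u u'; rewrite !scale1r.
have Tsum j r y : T j (\sum_(i <- r) y i) = \sum_(i <- r : seq I) T j (y i).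
  by elim: r => [|i r IH]; rewrite ?big_nil ?T0 // !big_cons TD IH.
elim: s x v => [|a s IH] x v Tx Tv sep; first by rewrite big_nil.
rewrite big_cons => vE; have [j wj] := sep a (mem_head a s).
have : (mu j - w a j) *: v = 0.
  apply: (IH (fun i => (w i j - w a j) *: x i)).
  - by move=> i k si; rewrite TZ Tx ?inE ?si ?orbT // !scalerA mulrC.
  - by move=> k; rewrite TZ Tv !scalerA mulrC.
  - by move=> i si; apply: sep; rewrite inE si orbT.
  rewrite scalerBl -Tv {1 2}vE TD Tx ?mem_head // scalerDr opprD addrACA subrr.
  rewrite add0r Tsum scaler_sumr -sumrB; apply: eq_big_seq => i si.
  by rewrite Tx ?scalerBl // inE si orbT.
move/eqP; rewrite scaler_eq0 subr_eq0 => /orP[/eqP E|/eqP //].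
by case: wj.
Qed.

(** * Root spaces *)

Section RootSpaces.
Variable R : realType.
Local Notation C := R[i].
Implicit Types (a b mu nu : hdual R) (H : hcartan R) (x y : KMF R).

Lemma cartan_incl_hc i : cartan_incl (hc R i) = h_ R i.
Proof.
rewrite /cartan_incl (bigD1 i) //= big1 => [|j /negPf ji].
  by rewrite mxE !eqxx scale1r addr0.
by rewrite mxE ji andbF; exact: scale0r.
Qed.

Lemma cartan_incl_linear (c : C) (H H' : hcartan R) :
  cartan_incl (c *: H + H') = c *: cartan_incl H + cartan_incl H'.
Proof.
rewrite /cartan_incl scaler_sumr -big_split; apply: eq_bigr => i _.
by rewrite !mxE scalerDl scalerA.
Qed.

Lemma root_space_subspace a : is_subspace (root_space a).
Proof.
split=> [H|c x y hx hy H]; first by rewrite bracket0r scaler0.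
by rewrite bracketDr bracketZr hx hy scalerDr !scalerA mulrC.
Qed.

Lemma root_space_bracket a b x y :
  root_space a x -> root_space b y -> root_space (a + b) (bracket x y).
Proof.
move=> hx hy H; rewrite bracket_derivation hx hy bracketZl bracketZr -scalerDl.
by rewrite !wevalE bformDr.
Qed.

Lemma bform_alphar mu j : bform mu (alpha R j) = \sum_i mu 0 i * (cartanA i j)%:~R.
Proof.
apply: eq_bigr => i _; rewrite (bigD1 j) //= big1 => [|k /negPf kj].
  by rewrite [alpha R j 0 j]mxE !eqxx mulr1 addr0.
by rewrite [alpha R j 0 k]mxE kj andbF mulr0.
Qed.

Lemma root_space_e j : root_space (alpha R j) (e_ R j).
Proof.
have [_ he _ _] := kac_moody_chevalley C cartanA.
move=> H; rewrite wevalE bform_alphar scaler_suml /cartan_incl bracket_suml.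
by apply: eq_bigr => i _; rewrite bracketZl he scalerA.
Qed.

Lemma root_space_f j : root_space (- alpha R j) (f_ R j).
Proof.
have [_ _ hf _] := kac_moody_chevalley C cartanA.
move=> H; rewrite wevalE bformNr bform_alphar -sumrN scaler_suml /cartan_incl.
rewrite bracket_suml.
by apply: eq_bigr => i _; rewrite bracketZl hf scalerA mulrN.
Qed.

Lemma root_space_h j : root_space 0 (h_ R j).
Proof.
have [hh _ _ _] := kac_moody_chevalley C cartanA.
move=> H; rewrite wevalE bform0r /cartan_incl bracket_suml scale0r.
by rewrite big1 // => i _; rewrite bracketZl hh scaler0.
Qed.

Lemma root_space_E i : root_space (beta R i) (E_ R i).
Proof.
move: i; apply: ord2P; last exact: root_space_e.
rewrite (_ : beta R 0 =
    alpha R i1 + (alpha R i1 + (alpha R i2 + alpha R i3))); last first.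
  by rewrite /beta /pair2 /= scaler_nat mulr2n -!addrA.
rewrite [E_ R 0](_ : _ = 2^-1 *: e1123 R) //.
apply: (subspaceZ (V := root_space _)); first exact: root_space_subspace.
by do 3! [apply: root_space_bracket; first exact: root_space_e]; exact: root_space_e.
Qed.

Lemma root_space_F i : root_space (- beta R i) (F_ R i).
Proof.
move: i; apply: ord2P; last exact: root_space_f.
rewrite (_ : - beta R 0 =
    - alpha R i1 + (- alpha R i1 + (- alpha R i2 + - alpha R i3))); last first.
  by rewrite -!opprD /beta /pair2 /= scaler_nat mulr2n -!addrA.
rewrite [F_ R 0](_ : _ = (- 2^-1) *: f1123 R); last by rewrite scaleNr.
apply: (subspaceZ (V := root_space _)); first exact: root_space_subspace.
by do 3! [apply: root_space_bracket; first exact: root_space_f]; exact: root_space_f.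
Qed.

End RootSpaces.

(** * The action on the levels *)

Section FibAction.
Variable R : realType.
Local Notation C := R[i].
Implicit Types (a b mu nu : hdual R) (H : hcartan R) (x y : KMF R).

Lemma bracket_E_F i : bracket (E_ R i) (F_ R i) = cartan_incl (H_ R i).
Proof.
have chev := kac_moody_chevalley C cartanA.
move: i; apply: ord2P; last first.
  case: chev => _ _ _ ef; rewrite [H_ R 1]/= cartan_incl_hc.
  by rewrite [LHS]ef eqxx scale1r.
have f13 : bracket (f_ R i1) (f_ R i3) = 0.
  have /(_ isT) := @kac_moody_serre_f C 3 cartanA i1 i3.
  by rewrite /serre_exp mxE.
rewrite [E_ R 0](_ : _ = 2^-1 *: e1123 R) //.
rewrite [F_ R 0](_ : _ = - (2^-1 *: f1123 R)) //.
rewrite bracketZl bracketNr bracketZr.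
rewrite [bracket (e1123 R) (f1123 R)](bracket_e1123_f1123 chev f13).
have -> : cartan_incl (H_ R 0) = 2 *: h_ R i1 + h_ R i2 + h_ R i3.
  rewrite /H_ /pair2 /= -!addrA cartan_incl_linear -[hc R i2]scale1r.
  by rewrite cartan_incl_linear !cartan_incl_hc scale1r.
rewrite scalerN !scalerA -scaleNr -[RHS]scale1r; congr (_ *: _).
by field.
Qed.

Lemma serre_cartanA (x : 'I_3 -> KMF R) :
    (forall i j : 'I_3, i != j ->
      iter (serre_exp cartanA i j) (bracket (x i)) (x j) = 0) ->
  [/\ iter 3 (bracket (x i1)) (x i2) = 0, bracket (x i1) (x i3) = 0
    & iter 2 (bracket (x i2)) (x i3) = 0].
Proof.
move=> h; split.
- by have := h i1 i2 isT; rewrite /serre_exp mxE.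
- by have := h i1 i3 isT; rewrite /serre_exp mxE.
- by have := h i2 i3 isT; rewrite /serre_exp mxE.
Qed.

Lemma ad_nilpotent_E i : ad_nilpotent (E_ R i).
Proof.
move: i; apply: ord2P; last exact: ad_nilpotent_km_e.
have [h12 h13 h23] := serre_cartanA (@kac_moody_serre_e C 3 cartanA).
apply: ad_nilpotentZ.
by apply: ad_nilpotent_bracket_1123 => //; exact: ad_nilpotent_km_e.
Qed.

Lemma ad_nilpotent_F i : ad_nilpotent (F_ R i).
Proof.
move: i; apply: ord2P; last exact: ad_nilpotent_km_f.
have [h12 h13 h23] := serre_cartanA (@kac_moody_serre_f C 3 cartanA).
rewrite [F_ R 0](_ : _ = (- 2^-1) *: f1123 R); last by rewrite scaleNr.
apply: ad_nilpotentZ.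
by apply: ad_nilpotent_bracket_1123 => //; exact: ad_nilpotent_km_f.
Qed.

Lemma root_space_iter a b x y m : root_space a x -> root_space b y ->
  root_space (b + m%:R *: a) (iter m (bracket x) y).
Proof.
move=> ax by_; elim: m => [|m IH]; first by rewrite scale0r addr0.
rewrite (_ : b + m.+1%:R *: a = a + (b + m%:R *: a)).
  exact: root_space_bracket.
by rewrite -natr1 scalerDl scale1r addrA [LHS]addrC.
Qed.

(** The string of E_ i and F_ i through a root vector reaches the reflected
root. *)
Lemma Phi_refl i b : Phi b -> Phi (reflFib i b).
Proof.
case=> b0 [x bx x0]; split.
  move=> /(congr1 (reflFib i)); rewrite reflFibK => b0'; apply: b0.
  by rewrite b0' reflFibE bform0r scale0r subr0.
have wtE : bracket (cartan_incl (H_ R i)) (E_ R i) = 2 *: E_ R i.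
  by rewrite root_space_E weval_H bform_beta_beta eqxx.
have wtF : bracket (cartan_incl (H_ R i)) (F_ R i) = (- 2) *: F_ R i.
  by rewrite root_space_F weval_H bformNr bform_beta_beta eqxx.
have wtx : bracket (cartan_incl (H_ R i)) x = bform (beta R i) b *: x.
  by rewrite bx weval_H.
have [n [[kn y0]|[kn y0]]] := sl2_reflection (bracket_E_F i) wtE wtF
  (ad_nilpotent_E i) (ad_nilpotent_F i) wtx x0.
- exists (iter n (bracket (F_ R i)) x) => //.
  rewrite reflFibE kn -scalerN; apply: root_space_iter => //.
  exact: root_space_F.
- exists (iter n (bracket (E_ R i)) x) => //.
  rewrite reflFibE kn scaleNr opprK; apply: root_space_iter => //.
  exact: root_space_E.
Qed.

Lemma Delta_refl m i b : Delta R m b -> Delta R m (reflFib i b).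
Proof.
case=> hb lev; split; last by rewrite reflFib_level.
case: hb => [/(Phi_refl i)|->]; first by left.
by right; rewrite reflFibE bform0r scale0r subr0.
Qed.

(** For b = 0 the root vector is h_1, so this rests on the nonvanishing of the
algebra. *)
Lemma Delta_root_vector m b : Delta R m b -> exists2 x, root_space b x & x <> 0.
Proof.
case=> [[[_ //]|->] _]; exists (h_ R i1); first exact: root_space_h.
exact: (@km_h_neq0 C 3 cartanA cartanA_gcm i1).
Qed.

Lemma FibLevel_subspace m : is_subspace (FibLevel R m).
Proof. by apply: subspace_sum_subspace; exact: root_space_subspace. Qed.

(** Meant for brackets of root vectors.  Such a bracket may vanish, and then its
weight need not be a root, or it may have weight 0; the level condition alone
suffices in all cases. *)
Lemma FibLevel_root_vector m b x :
  root_space b x -> 2 * b 0 i3 - b 0 i1 = m%:~R -> FibLevel R m x.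
Proof.
move=> bx lev; have [->|x0] := pselect (x = 0); first by case: (FibLevel_subspace m).
apply: (subspace_sum_in _ bx); split=> //.
by have [->|b0] := pselect (b = 0); [right | left; split=> //; exists x].
Qed.

Lemma FibLevel_bracket m a x v : root_space a x -> 2 * a 0 i3 - a 0 i1 = 0 ->
  FibLevel R m v -> FibLevel R m (bracket x v).
Proof.
move=> ax lev; move: v; apply: subspace_sum_sub.
  have [V0 Vlin] := FibLevel_subspace m.
  split=> [|c u v hu hv]; first by rewrite bracket0r.
  by rewrite bracketDr bracketZr; exact: Vlin.
move=> b [_ levb] v bv; apply: (FibLevel_root_vector (root_space_bracket ax bv)).
by rewrite !mxE -levb -[RHS]add0r -lev; ring.
Qed.

Lemma beta_level i : 2 * beta R i 0 i3 - beta R i 0 i1 = 0.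
Proof.
by move: i; apply: ord2P; rewrite /beta /pair2 /= !mxE /=; ring.
Qed.

(** The elements that preserve the level form a subalgebra, and it contains the
generators of Fib. *)
Lemma Fib_FibLevel m x v : Fib R x -> FibLevel R m v -> FibLevel R m (bracket x v).
Proof.
move=> Fx; move: v; move: x Fx.
have [V0 Vlin] := FibLevel_subspace m.
pose S := [set x | forall v, FibLevel R m v -> FibLevel R m (bracket x v)].
suff sub : is_lie_subalgebra S.
  move=> x Fx; apply: (Fx S); split=> // _ [i [->|[->|->]]] v.
  - exact: FibLevel_bracket (root_space_E i) (beta_level i).
  - apply: (FibLevel_bracket (root_space_F i)).
    by rewrite !mxE mulrN -opprD beta_level oppr0.
  - move: v; apply: subspace_sum_sub; last first.
      move=> b Db v bv; rewrite /= bv.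
      apply: (subspaceZ _ (FibLevel_subspace m)).
      exact: subspace_sum_in bv.
    split=> [|c u v hu hv]; first by rewrite bracket0r.
    by rewrite bracketDr bracketZr; exact: Vlin.
split; first split.
- by move=> v _; rewrite bracket0l.
- move=> c x y hx hy v Vv; rewrite bracketDl bracketZl.
  by apply: Vlin; [exact: hx | exact: hy].
- move=> x y hx hy v Vv; rewrite bracket_bracketl.
  apply: subspaceD; [exact: FibLevel_subspace|exact/hx/hy|].
  by rewrite -scaleN1r; apply: subspaceZ; [exact: FibLevel_subspace|exact/hy/hx].
Qed.

Lemma FibLevel_module m : is_lie_module (Fib R) (KMF R) (FibLevel R m) bracket.
Proof.
split.
- exact: FibLevel_subspace.
- exact: Fib_FibLevel.
- by move=> c x y v _ _ _; rewrite bracketDl bracketZl.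
- by move=> c x u v _ _ _; rewrite bracketDr bracketZr.
- by move=> x y v _ _ _; exact: bracket_bracketl.
Qed.

Lemma root_space_proj b x H : root_space b x -> cartanFib H ->
  bracket (cartan_incl H) x = weval (projFib R b) H *: x.
Proof. by move=> bx FH; rewrite weval_projFib. Qed.

Local Notation weight m := (weight_space (KMF R) (FibLevel R m) bracket).

Lemma weight_space_subspace m mu : is_subspace (weight m mu).
Proof.
have [V0 Vlin] := FibLevel_subspace m.
split=> [|c u v [Vu hu] [Vv hv]].
  by split=> // H _; rewrite bracket0r scaler0.
split=> [|H FH]; first exact: Vlin.
by rewrite bracketDr bracketZr hu // hv // scalerDr !scalerA mulrC.
Qed.

Lemma root_weight_space m b x : Delta R m b -> root_space b x ->
  weight m (projFib R b) x.
Proof.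
move=> Db bx; split=> [|H FH]; first exact: subspace_sum_in bx.
exact: root_space_proj.
Qed.

Lemma weight_sum_separated (I : eqType) (s : seq I) (x : I -> KMF R)
    (w : I -> hdual R) v mu :
    (forall i, i \in s -> [/\ dualFib (w i), w i <> mu &
       forall H, cartanFib H ->
         bracket (cartan_incl H) (x i) = weval (w i) H *: x i]) ->
    dualFib mu ->
    (forall H, cartanFib H -> bracket (cartan_incl H) v = weval mu H *: v) ->
  v = \sum_(i <- s) x i -> v = 0.
Proof.
move=> hs dmu hv.
apply: (@eigenvector_sum_separated C (KMF R) 'I_2 I
  (fun j => bracket (cartan_incl (H_ R j))) s x
  (fun i j => weval (w i) (H_ R j)) v (fun j => weval mu (H_ R j))).
- by move=> j a u u'; rewrite bracketDr bracketZr.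
- by move=> i j /hs[_ _]; apply; exact: cartanFib_H.
- by move=> j; exact/hv/cartanFib_H.
- move=> i /hs[dw wmu _]; apply: contrapT => h; apply: wmu.
  by apply: dualFib_separated => // j; apply: contrapT => hj; apply: h; exists j.
Qed.

Lemma FibLevel_diagonalizable m : hFib_diagonalizable (KMF R) (FibLevel R m) bracket.
Proof.
split.
  apply/seteqP; split.
    apply: subspace_sum_sub => [|b Db x bx].
      exact/subspace_sum_subspace/weight_space_subspace.
    apply: (@subspace_sum_in _ _ _ _ _ (projFib R b)); first exact: dualFib_proj.
    exact: root_weight_space.
  by apply: subspace_sum_sub => [|mu _ v []]; first exact: FibLevel_subspace.
move=> s x us hx sx0 i si; have [di [_ hi]] := hx i si.
apply/eqP; rewrite -oppr_eq0; apply/eqP.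
apply: (@weight_sum_separated _ (rem i s) x id _ i) => //.
- move=> j; rewrite mem_rem_uniq // => /andP[/eqP ji js].
  by have [dj [_ hj]] := hx j js; split.
- by move=> H FH; rewrite bracketNr hi // scalerN.
- by move/eqP: sx0; rewrite (big_rem i si) /= addrC addr_eq0 => /eqP.
Qed.

(** If no root occurring in a weight vector projected to its weight, the vector
would vanish by separation of eigenvalues. *)
Lemma FibLevel_weights m :
  weights (KMF R) (FibLevel R m) bracket = projFib R @` Delta R m.
Proof.
apply/seteqP; split=> [mu [dmu [v [Vv hv] v0]]|_ [b Db <-]]; last first.
  have [x bx x0] := Delta_root_vector Db.
  by split; [exact: dualFib_proj | exists x => //; exact: root_weight_space].
apply: contrapT => nmu; apply: v0; case: Vv => s [x [us sx vE]].
apply: (@weight_sum_separated _ s x (projFib R) v mu) => // b /sx[Db bx].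
split; first exact: dualFib_proj.
- by move=> E; apply: nmu; exists b.
- by move=> H; exact: root_space_proj.
Qed.

End FibAction.

(** * The projection on hyperplanes and dominant weights *)

Lemma fundamental_in_root_span (K : numFieldType) n (x y : 'rV[K]_n) r :
  r *: - (5^-1 *: (2 *: x + 3 *: y)) =
    (- (5^-1 * 2) * r) *: x + (- (5^-1 * 3) * r) *: y /\
  r *: - (5^-1 *: (3 *: x + 2 *: y)) =
    (- (5^-1 * 3) * r) *: x + (- (5^-1 * 2) * r) *: y.
Proof. by split; apply/rowP => j; rewrite !mxE; ring. Qed.

Section Projection.
Variable R : realType.
Local Notation C := R[i].
Implicit Types mu : hdual R.

Lemma hdualR_beta i : hdualR (beta R i).
Proof.
move: i; apply: ord2P => j; rewrite /beta /pair2 /= !mxE ?realn //.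
by rewrite !realD ?realM ?realn.
Qed.

Lemma hdualR_bform i mu : hdualR mu -> bform (beta R i) mu \is Num.real.
Proof.
move=> Rmu; apply: rpred_sum => j _; apply: rpred_sum => k _.
rewrite realM //; apply: realM; first exact: hdualR_beta.
exact: realz.
Qed.

Lemma dualFibR_sub mu : dualFibR R mu -> hdualR mu /\ dualFib mu.
Proof.
case=> c Rc ->; split; last by exists c.
move=> j; rewrite summxE; apply: rpred_sum => i _; rewrite mxE.
by apply: realM; [exact: Rc | exact: hdualR_beta].
Qed.

Lemma dualFibR_lambda (r : C) i : r \is Num.real -> dualFibR R (r *: lambda R i).
Proof.
move=> Rr; have Rq : (5^-1 : C) \is Num.real by rewrite realV realn.
exists (fun j => - (5^-1 * (if j == i then 2 else 3)) * r).
  by move=> j; rewrite realM // realN realM //; case: ifP => _; rewrite realn.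
have [l0 l1] := fundamental_in_root_span (beta R 0) (beta R 1) r.
by rewrite sum_ord2; move: i; apply: ord2P.
Qed.

Lemma projFib_betaperp i mu : bform mu (beta R i) = 0 ->
  projFib R mu = bform (beta R (rev_ord i)) mu *: lambda R (rev_ord i).
Proof.
rewrite bformC => mui; rewrite /projFib (bigD1 (rev_ord i)) //= weval_H.
rewrite [X in _ + X]big1 ?addr0 // => j ji; rewrite weval_H.
suff -> : j = i by rewrite mui; exact: scale0r.
by move: i j ji {mui}; apply: ord2P; apply: ord2P.
Qed.

Lemma betaperp_lambda (r : C) i : r \is Num.real ->
  betaperp R i (r *: lambda R (rev_ord i)).
Proof.
move=> Rr; split; first by case: (dualFibR_sub (dualFibR_lambda (rev_ord i) Rr)).
rewrite bformC bformZr bform_beta_lambda.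
by move: i; apply: ord2P; rewrite mulr0.
Qed.

Lemma projFib_lambda (r : C) i : r \is Num.real ->
  projFib R (r *: lambda R i) = r *: lambda R i.
Proof. by move=> Rr; apply: projFib_id; case: (dualFibR_sub (dualFibR_lambda i Rr)). Qed.

(** The coefficients of the projection are (beta_i, mu), and beta_1 and beta_2
are sums of simple roots with nonnegative integer coefficients. *)
Lemma projFib_Pplus : projFib R @` Pplus R `<=` PFibplus R.
Proof.
move=> _ [mu [Pmu mu0] <-].
have nat_alpha j : exists n : nat, bform (alpha R j) mu = n%:R.
  have [z] := Pmu j; have := mu0 j; rewrite coform_alpha => + zE.
  by rewrite zE ler0z => /ZnatP [n nE]; exists n; rewrite nE.
have [n1 E1] := nat_alpha i1; have [n2 E2] := nat_alpha i2.
have [n3 E3] := nat_alpha i3.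
exists (pair2 (2 * n1 + n2 + n3)%N n2); apply: eq_bigr => i _; congr (_ *: _).
rewrite weval_H; move: i; apply: ord2P; last exact: E2.
rewrite [pair2 _ _ 0](_ : _ = (2 * n1 + n2 + n3)%N) // 2!natrD natrM -E1 -E2 -E3.
rewrite /beta /pair2 /= -addrA bformDZl.
by rewrite -[alpha R i2]scale1r bformDZl scale1r mul1r addrA.
Qed.

Lemma projFib_Pminus : projFib R @` Pminus R `<=` PFibminus R.
Proof.
move=> _ [_ [mu Pmu <-] <-]; exists (projFib R mu); last by rewrite projFibN.
by apply: projFib_Pplus; exists mu.
Qed.

End Projection.

Theorem proposition3p1 (R : realType) :
  (forall m : int,
    [/\ is_lie_module (Fib R) (KMF R) (FibLevel R m) bracket,
        hFib_diagonalizable (KMF R) (FibLevel R m) bracket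
      & Fib_integrable (KMF R) (FibLevel R m) bracket]
    /\
    [/\ weights (KMF R) (FibLevel R m) bracket = projFib R @` Delta R m,
        forall (b : hdual R) (x : KMF R), Delta R m b -> root_space b x ->
          forall H : hcartan R, cartanFib H ->
            bracket (cartan_incl H) x = weval (projFib R b) H *: x,
        WFib_invariant (Delta R m)
      & WFib_invariant (weights (KMF R) (FibLevel R m) bracket)])
  /\
  (forall i : 'I_2,
     projFib R @` betaperp R i
       = [set r *: lambda R (rev_ord i) | r in [set r : R[i] | r \is Num.real]]
     /\ [set r *: lambda R (rev_ord i) | r in [set r : R[i] | r \is Num.real]]
       = betaperp R i `&` dualFibR R)
  /\
  (projFib R @` Pplus R `<=` PFibplus R /\
   projFib R @` Pminus R `<=` PFibminus R).
Proof.
split=> [m|]; [split; split|split=> [i|]; split].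
- exact: FibLevel_module.
- exact: FibLevel_diagonalizable.
- split=> [|i]; first exact: FibLevel_diagonalizable.
  by split=> v _; [exact: ad_nilpotent_E | exact: ad_nilpotent_F].
- exact: FibLevel_weights.
- by move=> b x _ bx H; exact: root_space_proj.
- by apply: WFib_invariantP => i b; exact: Delta_refl.
- apply: WFib_invariantP => i mu; rewrite FibLevel_weights => -[b Db <-].
  by exists (reflFib i b); [exact: Delta_refl | exact: projFib_refl].
- apply/seteqP; split=> [_ [mu [Rmu mui] <-]|_ [r Rr <-]].
    by rewrite (projFib_betaperp mui); eexists; [|reflexivity]; exact: hdualR_bform.
  exists (r *: lambda R (rev_ord i)); first exact: betaperp_lambda.
  exact: projFib_lambda.
- apply/seteqP; split=> [_ [r Rr <-]|mu [[Rmu mui] Dmu]].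
    by split; [exact: betaperp_lambda | exact: dualFibR_lambda].
  have [_ /projFib_id <-] := dualFibR_sub Dmu.
  by rewrite (projFib_betaperp mui); eexists; [|reflexivity]; exact: hdualR_bform.
- exact: projFib_Pplus.
- exact: projFib_Pminus.
Qed.
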